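(* Let $n \geq 2$. Suppose that the Kakeya maximal function conjecture holds in $\mathbb{R}^{n}$, i.e. for every $\epsilon > 0$ there is a constant $C(\epsilon)$ such that $$\|M_{\delta}f\|_{L^{n}(S^{n-1})} \leq C(\epsilon)\, \delta^{-\epsilon}\, \|f\|_{L^{n}(\mathbb{R}^{n})}$$ for all $0 < \delta < 1$ and all $f \in L^{n}(\mathbb{R}^{n})$. Assume that $K \subset \mathbb{R}^{n}$ is a Kakeya set, $(X,d)$ is a metric space with $\dim_{\mathrm{H}} X \leq n$, and $g \colon K \to (X,d)$ is a quasisymmetric homeomorphism (onto $X$). Then $$\dim_{\mathrm{H}} g(L_{e}(x)) = 1$$ for $\mathcal{H}^{n-1}$-almost all line segments $L_{e}(x) \subset K$; that is, the set of directions $e \in S^{n-1}$ for which there is $x \in \mathbb{R}^{n}$ with $L_{e}(x) \subset K$ and $\dim_{\mathrm{H}} g(L_{e}(x)) \neq 1$ has zero $\mathcal{H}^{n-1}$-measure.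
   Context: For $e \in S^{n-1}$ and $x \in \mathbb{R}^{n}$, write $L_{e}(x) = \{x + te : 0 \leq t \leq 1\}$, and for $\delta > 0$ let $T_{e}^{\delta}(x)$ be the closed $\delta$-neighbourhood of $L_{e}(x)$ in $\mathbb{R}^{n}$. For a locally integrable function $f$ on $\mathbb{R}^{n}$, the Kakeya maximal function $M_{\delta}f \colon S^{n-1} \to [0,\infty]$ is $$(M_{\delta}f)(e) := \sup_{x \in \mathbb{R}^{n}} \frac{1}{|T_{e}^{\delta}(x)|} \int_{T_{e}^{\delta}(x)} |f(y)| \, dy,$$ where $|\cdot|$ is Lebesgue measure. The sphere $S^{n-1}$ is equipped with $(n-1)$-dimensional Hausdorff (outer) measure $\mathcal{H}^{n-1}$, and $\dim_{\mathrm{H}}$ is Hausdorff dimension. A set $K \subset \mathbb{R}^{n}$, $n \geq 2$, is called a Kakeya set if there exists a set $S \subset S^{n-1}$ of positive $\mathcal{H}^{n-1}$-measure such that for every $e \in S$ the set $K$ contains a unit line segment of the form $L_{e}(x)$ for some $x \in \mathbb{R}^{n}$. A homeomorphism $g$ from a metric space $(X_1,d_1)$ onto a metric space $(X_2,d_2)$ is quasisymmetric if there exists an increasing homeomorphism $\eta \colon [0,\infty) \to [0,\infty)$ such that $$\frac{d_2(g(x),g(y))}{d_2(g(x),g(z))} \leq \eta\left(\frac{d_1(x,y)}{d_1(x,z)}\right)$$ for all $x,y,z \in X_1$ with $x \neq z$. The set $K$ carries the Euclidean metric. *)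

(* Defs.v *)
From HB Require Import structures.
From mathcomp Require Import all_boot all_order all_algebra.
From mathcomp Require Import ring lra.
From mathcomp Require Import all_classical all_reals all_analysis.
Import Order.TTheory GRing.Theory Num.Theory.
Import numFieldNormedType.Exports.
Set Implicit Arguments.
Unset Strict Implicit.
Unset Printing Implicit Defensive.
Local Open Scope classical_set_scope.
Local Open Scope ring_scope.

Section cover_outer_measure.
Local Open Scope ereal_scope.
Context (R : realType) (T I : Type).
Variables (P : set I) (B : I -> set T) (w : I -> \bar R).

(* The covers are the families [F] indexed by a subset [D] of the naturals, so
   finite covers and the empty cover are allowed. *)
Definition cover_outer_measure (A : set T) : \bar R :=
  ereal_inf [set r | exists (D : set nat) (F : nat -> I),
    [/\ forall k, D k -> P (F k),
        A `<=` \bigcup_(k in D) B (F k)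
      & r = \sum_(0 <= k <oo | k \in D) w (F k)]].

Hypotheses (i0 : I) (w_ge0 : forall i, P i -> 0 <= w i).

Lemma cover_outer_measure_ge0 A : 0 <= cover_outer_measure A.
Proof.
apply: le_ereal_inf_tmp => _ [D [F [PF _ ->]]].
by apply: nneseries_ge0 => k _ /set_mem /PF; exact: w_ge0.
Qed.

Lemma cover_outer_measure0 : cover_outer_measure set0 = 0.
Proof.
apply/eqP; rewrite eq_le cover_outer_measure_ge0 andbT.
apply: ereal_inf_lbound; exists set0, (fun=> i0); split => //.
by rewrite eseries0// => k _; rewrite in_set0.
Qed.

Lemma le_cover_outer_measure :
  {homo cover_outer_measure : A A' / A `<=` A' >-> A <= A'}.
Proof.
move=> A A' AA'; apply: ereal_inf_le_tmp => _ [D [F [PF cF ->]]].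
by exists D, F; split => //; exact: subset_trans cF.
Qed.

Lemma cover_outer_measure_sigma_subadditive :
  sigma_subadditive cover_outer_measure.
Proof.
set m := cover_outer_measure.
move=> A; have [[i ioo]|] := pselect (exists i, m (A i) = +oo).
  rewrite (eseries_pinfty _ _ ioo) ?leey// => n _.
  by rewrite -ltNye (lt_le_trans _ (cover_outer_measure_ge0 _)).
rewrite -forallNE => Aoo.
apply/lee_addgt0Pr => e e0.
rewrite (le_trans _ (epsilon_trick _ _ (ltW e0)))//; last first.
  by move=> n; exact: cover_outer_measure_ge0.
pose Q n (DF : set nat * (nat -> I)) :=
  [/\ forall k, DF.1 k -> P (DF.2 k),
      A n `<=` \bigcup_(k in DF.1) B (DF.2 k)
    & \sum_(0 <= k <oo | k \in DF.1) w (DF.2 k)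
        <= m (A n) + (e / (2 ^ n.+1)%:R)%:E].
have [G QG] : {G : nat -> set nat * (nat -> I) & forall n, Q n (G n)}.
  apply: (@choice _ _ Q) => n.
  have en : (0 < e / (2 ^ n.+1)%:R :> R)%R by rewrite divr_gt0// ltr0n expn_gt0.
  have mfin : m (A n) \is a fin_num.
    rewrite fin_numElt (lt_le_trans _ (cover_outer_measure_ge0 _))//=.
    by rewrite ltey; exact/eqP/Aoo.
  have [_ [D [F [PF cF ->]]] lF] := lb_ereal_inf_adherent en mfin.
  by exists (D, F); split => //; exact/ltW.
pose u (p : nat * nat) : \bar R :=
  if p.2 \in (G p.1).1 then w ((G p.1).2 p.2) else 0.
have u_ge0 p : 0 <= u p.
  rewrite /u; case: ifPn => // /set_mem; have [PG _ _] := QG p.1.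
  by move/PG; exact: w_ge0.
apply: (@le_trans _ _ (\esum_(p in setT) u p)).
  have /card_esym/ppcard_eqP[f] := card_nat2.
  apply: ereal_inf_lbound.
  exists [set k | (G (f k).1).1 (f k).2], (fun k => (G (f k).1).2 (f k).2).
  split=> [k /=|t [n _ Ant]|].
  - by have [+ _ _] := QG (f k).1; exact.
  - have [_ /(_ _ Ant)[k Dk Bk] _] := QG n.
    by exists (f^-1%FUN (n, k)); rewrite /= invK ?inE.
  - rewrite (reindex_esum setT setT f); last exact: bij.
    rewrite -nneseries_esumT// [RHS]eseries_mkcond.
    apply: eq_eseriesr => k _; rewrite /u.
    by congr (if _ then _ else _); apply/idP/idP; rewrite !inE.
rewrite (_ : esum _ _ = \sum_(0 <= i <oo) \sum_(0 <= j <oo) u (i, j)).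
  apply: lee_nneseries => [n _ _|n _]; first exact: nneseries_ge0.
  have [_ _] := QG n; apply: le_trans.
  by rewrite [leRHS]eseries_mkcond.
rewrite nneseries_esumT; last by move=> n; exact: nneseries_ge0.
under [RHS]eq_esum => i _ do rewrite nneseries_esumT//.
rewrite (@esum_esum _ _ _ setT (fun=> setT) (fun i j => u (i, j)))//.
by rewrite (_ : _ `*`` _ = setT); [apply: eq_esum => -[]|apply/seteqP].
Qed.

End cover_outer_measure.

Section hausdorff.
Local Open Scope ereal_scope.
Context (R : realType) (T : metricType R).
Implicit Types (A : set T) (s d : R).

Definition diam A : \bar R :=
  ereal_sup (0 |` [set (mdist p.1 p.2)%:E | p in A `*` A]).

Definition hausdorff_content s d : set T -> \bar R :=
  cover_outer_measure [set U | diam U <= d%:E] id (fun U => diam U `^ s).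

(* The limit as [d] tends to 0 is a supremum, since [hausdorff_content s d] is
   nonincreasing in [d]. No normalizing constant is used. *)
Definition hausdorff_measure s A : \bar R :=
  ereal_sup [set hausdorff_content s d A | d in [set d | (0 < d)%R]].

Lemma hausdorff_content_le s d A :
  (0 < d)%R -> hausdorff_content s d A <= hausdorff_measure s A.
Proof. by move=> d0; apply: ereal_sup_ubound; exists d. Qed.

Lemma hausdorff_measure0 s : hausdorff_measure s set0 = 0.
Proof.
rewrite /hausdorff_measure (_ : [set _ | _ in _] = [set 0]) ?ereal_sup1//.
have h0 d : hausdorff_content s d set0 = 0.
  by apply: (cover_outer_measure0 id set0) => U _; exact: poweR_ge0.
apply/seteqP; split=> [_ [d _ <-]|_ ->]; first exact: h0.
by exists 1%R; rewrite /= ?ltr01.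
Qed.

Lemma hausdorff_measure_ge0 s A : 0 <= hausdorff_measure s A.
Proof.
apply: le_trans (hausdorff_content_le s A ltr01).
by apply: cover_outer_measure_ge0 => U _; exact: poweR_ge0.
Qed.

Lemma le_hausdorff_measure s :
  {homo hausdorff_measure s : A B / A `<=` B >-> A <= B}.
Proof.
move=> A B AB; apply: ge_ereal_sup => _ [d /= d0 <-].
apply: le_trans (hausdorff_content_le s B d0).
exact: le_cover_outer_measure.
Qed.

Lemma hausdorff_measure_sigma_subadditive s :
  sigma_subadditive (hausdorff_measure s).
Proof.
move=> F; apply: ge_ereal_sup => _ [d /= d0 <-].
have w0 (U : set T) : diam U <= d%:E -> 0 <= diam U `^ s.
  by move=> _; exact: poweR_ge0.
apply: le_trans (cover_outer_measure_sigma_subadditive id w0 F) _.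
apply: lee_nneseries => [k _ _|k _]; last exact: hausdorff_content_le.
exact: cover_outer_measure_ge0.
Qed.

HB.instance Definition _ s := isOuterMeasure.Build R T (hausdorff_measure s)
  (hausdorff_measure0 s) (hausdorff_measure_ge0 s) (@le_hausdorff_measure s)
  (@hausdorff_measure_sigma_subadditive s).

Definition hausdorff_dim A : \bar R :=
  ereal_inf [set s%:E | s in [set s | (0 <= s)%R /\ hausdorff_measure s A = 0]].

End hausdorff.

Section subset_metric.
Context {R : realType} {T : metricType R} (A : set T).

Let dist (x y : set_type A) : R := mdist (set_val x) (set_val y).

Let dist_ge0 x y : 0 <= dist x y.
Proof. exact: mdist_ge0. Qed.

Let dist_positivity x y : dist x y = 0 -> x = y.
Proof. by move/mdist_positivity/val_inj. Qed.

Let ballEdist (x : set_type A) d : ball x d = [set y | dist x y < d].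
Proof. by rewrite -initial_ballE ballEmdist. Qed.

HB.instance Definition _ := @PseudoMetric_isMetric.Build R (set_type A)
  dist dist_ge0 dist_positivity ballEdist.

End subset_metric.

Definition homeomorphism_between (T U : topologicalType) (A : set T) (B : set U)
    (f : T -> U) : Prop :=
  [/\ set_bij A B f, {within A, continuous f}
    & exists f' : U -> T, {in A, cancel f f'} /\ {within B, continuous f'}].

Definition quasisymmetric (R : realType) (T U : metricType R) (g : T -> U) :=
  homeomorphism_between [set: T] [set: U] g /\
  exists eta : R -> R,
    [/\ homeomorphism_between [set t : R | 0 <= t] [set t : R | 0 <= t] eta,
        {in [set t : R | 0 <= t] &, {homo eta : s t / s < t}}
      & forall x y z : T, x <> z ->
          mdist (g x) (g y) / mdist (g x) (g z)
            <= eta (mdist x y / mdist x z)].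

(* The library's topological structure on ['rV[R]_n] comes from the sup norm, so
   the Euclidean metric is put on an alias. *)
Definition euclidean (R : realType) (n : nat) : Type := 'rV[R]_n.

Section euclidean.
Context (R : realType) (n : nat).
Implicit Types x y z e : euclidean R n.

HB.instance Definition _ := GRing.Lmodule.copy (euclidean R n) 'rV[R]_n.
HB.instance Definition _ := Pointed.copy (euclidean R n) 'rV[R]_n.

Definition enorm x : R := Num.sqrt (\sum_(i < n) x ord0 i ^+ 2).

Let sumsq x := \sum_(i < n) x ord0 i ^+ 2.
Let dot x y := \sum_(i < n) x ord0 i * y ord0 i.

Let sumsq_ge0 x : 0 <= sumsq x.
Proof. by apply: sumr_ge0 => i _; exact: sqr_ge0. Qed.

Let sumsqD (t : R) x y :
  sumsq (t *: x + y) = t ^+ 2 * sumsq x + 2 * t * dot x y + sumsq y.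
Proof.
rewrite /sumsq /dot !mulr_sumr -!big_split/=.
by apply: eq_bigr => i _; rewrite !mxE; ring.
Qed.

Let sumsq_eq0 x : sumsq x = 0 -> x = 0.
Proof.
move=> /eqP; rewrite psumr_eq0; last by move=> i _; exact: sqr_ge0.
move=> /allP h; apply/rowP => i; rewrite mxE; apply/eqP.
by have := h i (mem_index_enum i); rewrite sqrf_eq0.
Qed.

Let dot_le x y : dot x y <= enorm x * enorm y.
Proof.
rewrite /enorm -/(sumsq x) -/(sumsq y) -sqrtrM//.
apply: le_trans (ler_norm _) _; rewrite -sqrtr_sqr ler_wsqrtr//.
have [x0|x0] := eqVneq (sumsq x) 0.
  rewrite x0 mul0r (_ : dot x y = 0) ?expr0n//.
  by rewrite /dot (sumsq_eq0 x0) big1// => i _; rewrite mxE mul0r.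
have xp : 0 < sumsq x by rewrite lt0r x0 sumsq_ge0.
have := sumsq_ge0 (- (dot x y / sumsq x) *: x + y).
rewrite sumsqD -(pmulr_rge0 _ xp).
move: (sumsq x) (sumsq y) (dot x y) x0 => a c b a0.
suff -> : a * ((- (b / a)) ^+ 2 * a + 2 * - (b / a) * b + c) = a * c - b ^+ 2.
  by rewrite subr_ge0.
by field.
Qed.

Let sqr_enorm x : enorm x ^+ 2 = sumsq x.
Proof. by rewrite sqr_sqrtr//; exact: sumsq_ge0. Qed.

Let enormD x y : enorm (x + y) <= enorm x + enorm y.
Proof.
rewrite -ler_sqr ?nnegrE ?addr_ge0 ?sqrtr_ge0// sqrrD !sqr_enorm.
rewrite -[X in X + y]scale1r sumsqD expr1n mul1r mulr1 -mulr_natl.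
by have := dot_le x y; lra.
Qed.

Let edist x y : R := enorm (x - y).

Let edistxx x : edist x x = 0.
Proof.
by rewrite /edist subrr /enorm big1 ?sqrtr0// => i _; rewrite mxE expr0n.
Qed.

Let edist_positivity x y : edist x y = 0 -> x = y.
Proof.
move=> /eqP; rewrite sqrtr_eq0 => le0; apply/eqP; rewrite -subr_eq0.
by apply/eqP/sumsq_eq0/le_anti; rewrite le0 sumsq_ge0.
Qed.

Let edist_sym x y : edist x y = edist y x.
Proof.
rewrite /edist /enorm; congr Num.sqrt; apply: eq_bigr => i _.
by rewrite !mxE -sqrrN opprB.
Qed.

Let edist_triangle y x z : edist x z <= edist x y + edist y z.
Proof. by rewrite /edist -(subrKA y) enormD. Qed.

HB.instance Definition _ := isMetric.Build R (euclidean R n)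
  edistxx edist_positivity edist_sym edist_triangle.

Definition box (ab : euclidean R n * euclidean R n) : set (euclidean R n) :=
  [set x | forall i, ab.1 ord0 i <= x ord0 i <= ab.2 ord0 i].

Definition box_volume (ab : euclidean R n * euclidean R n) : \bar R :=
  (\prod_(i < n) (ab.2 ord0 i - ab.1 ord0 i))%:E.

Definition lebesgue_outer : set (euclidean R n) -> \bar R :=
  cover_outer_measure
    [set ab : euclidean R n * euclidean R n |
      forall i, ab.1 ord0 i <= ab.2 ord0 i] box box_volume.

Let box_volume_ge0 (ab : euclidean R n * euclidean R n) :
  (forall i, ab.1 ord0 i <= ab.2 ord0 i) -> (0 <= box_volume ab)%E.
Proof.
by move=> h; rewrite lee_fin; apply: prodr_ge0 => i _; rewrite subr_ge0.
Qed.

Let lebesgue_outer0 : lebesgue_outer set0 = 0%E.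
Proof. exact: (cover_outer_measure0 box (0, 0) box_volume_ge0). Qed.

Let lebesgue_outer_ge0 A : (0 <= lebesgue_outer A)%E.
Proof. by apply: cover_outer_measure_ge0 => ab; exact: box_volume_ge0. Qed.

Let le_lebesgue_outer : {homo lebesgue_outer : A B / A `<=` B >-> (A <= B)%E}.
Proof. exact: le_cover_outer_measure. Qed.

Let lebesgue_outer_sigma_subadditive : sigma_subadditive lebesgue_outer.
Proof.
by apply: cover_outer_measure_sigma_subadditive => ab; exact: box_volume_ge0.
Qed.

HB.instance Definition _ :=
  isOuterMeasure.Build R (euclidean R n) lebesgue_outer lebesgue_outer0
    lebesgue_outer_ge0 le_lebesgue_outer lebesgue_outer_sigma_subadditive.

End euclidean.

Section kakeya.
Context (R : realType) (n : nat).
Local Notation E := (euclidean R n).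
Implicit Types (e x : E) (K : set E).

(* The measures induced by the two outer measures on their Caratheodory-measurable
   sets; for [lebesgue_outer] these sets are the Lebesgue-measurable ones. *)
Definition lebesgue_euclidean :
    {measure set (caratheodory_type (@lebesgue_outer R n)) -> \bar R} :=
  [the measure _ _ of
    ([the {outer_measure set E -> \bar R} of @lebesgue_outer R n]
     : set (caratheodory_type (@lebesgue_outer R n)) -> \bar R)].

Definition hausdorff_euclidean (s : R) :
    {measure set (caratheodory_type (@hausdorff_measure R E s)) -> \bar R} :=
  [the measure _ _ of
    ([the {outer_measure set E -> \bar R} of @hausdorff_measure R E s]
     : set (caratheodory_type (@hausdorff_measure R E s)) -> \bar R)].

Definition unit_sphere : set E := [set e | enorm e = 1].

Definition unit_segment e x : set E :=
  [set x + t *: e | t in [set t : R | 0 <= t <= 1]].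

Definition tube (delta : R) e x : set E :=
  [set y | exists2 z, unit_segment e x z & mdist y z <= delta].

Definition kakeya_maximal (delta : R) (f : E -> R) (e : E) : \bar R :=
  ereal_sup [set ((lebesgue_euclidean (tube delta e x))^-1 *
                  \int[lebesgue_euclidean]_(y in tube delta e x) `|f y|%:E)%E
                | x in [set: E]].

Definition kakeya_maximal_conjecture : Prop :=
  forall eps : R, 0 < eps -> exists C : R,
  forall (delta : R) (f : E -> R), 0 < delta < 1 ->
    f \in Lfun lebesgue_euclidean n%:R%:E ->
    ('N[hausdorff_euclidean n.-1%:R]_(n%:R%:E)
         [kakeya_maximal delta f \_ unit_sphere]
      <= (C * delta `^ (- eps))%:E *
           'N[lebesgue_euclidean]_(n%:R%:E) [EFin \o f])%E.

Definition kakeya_set K : Prop :=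
  exists S : set E,
    [/\ S `<=` unit_sphere, (0 < hausdorff_measure n.-1%:R S)%E
      & forall e, S e -> exists x, unit_segment e x `<=` K].

End kakeya.

(* Main.v *)
Require Import Defs.
From HB Require Import structures.
From mathcomp Require Import all_boot all_order all_algebra.
From mathcomp Require Import ring lra zify.
From mathcomp Require Import all_classical all_reals all_analysis.
From mathcomp Require Import measurable_realfun.
Import Order.TTheory GRing.Theory Num.Theory.
Import numFieldNormedType.Exports.
Set Implicit Arguments.
Unset Strict Implicit.
Unset Printing Implicit Defensive.
Local Open Scope classical_set_scope.
Local Open Scope ring_scope.

(* The inequality [dim g(L) >= 1] holds for every segment [L], because the distance
   to an end point of [g(L)] maps the connected set [g(L)] 1-Lipschitz onto an interval.

   For the converse, suppose that [H^(1 + 2 b)] of [g(L_e)] is positive for many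
   directions [e].  Since [n (1 + b) > n >= dim X], [X] is covered by sets [F_k] with
   [sum_k (diam F_k)^(n (1 + b)) <= tau], and quasisymmetry bounds the image of any
   ball centred on [V_k = g^-1(F_k)] of radius comparable to [diam V_k] by a multiple
   of [diam F_k].  Sort the indices by the scale [diam V_k ~ l^-(j+1)].  Quasisymmetry
   along a segment also gives images of size [O(q^j)] at scale [j], where
   [q = eta (1 / l)] is as small as we like.  In [diam^(1 + 2 b) = diam^(1 + b) diam^b]
   the last factor is therefore [O(8^-j)], and so, for each bad [e], at some scale [j]
   the pieces of [L_e] of length [l^-(j+1)] that meet a [V_k] of that scale satisfy
   [sum diam^(1 + b) >= kappa 4^j], the sum being over the diameters of their images.
   The function equal to [(diam F_k)^(1 + b)] near [V_k] then has a large average on a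
   tube of width [l^-(j+1)] in the direction [e], and the maximal inequality bounds the
   measure of such directions by [O(tau 2^-j)].  Sum over [j] and let [tau] tend to 0. *)

(** * Metric outer measures and Hausdorff measure *)

Section metric_outer_measure.
Local Open Scope ereal_scope.
Context {R : realType} {T : metricType R}.

(** Caratheodory's metric condition, stated as one inequality since the reverse one is
    subadditivity. *)
Definition metric_additive (mu : set T -> \bar R) := forall (A B : set T) (r : R),
  (0 < r)%R -> (forall a b, A a -> B b -> (r <= mdist a b)%R) ->
  mu A + mu B <= mu (A `|` B).

Variable mu : {outer_measure set T -> \bar R}.
Hypothesis mu_metric : metric_additive mu.
Variable C : set T.
Hypothesis C_separated : forall x, ~ C x ->
  exists2 r : R, (0 < r)%R & forall y, C y -> (r <= mdist x y)%R.
Variable A : set T.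

Let far k := A `&` [set x | forall y, C y -> (k.+1%:R^-1 <= mdist x y)%R].
Let layer k := far k.+1 `\` far k.

Let far_homo k l : (k <= l)%N -> far k `<=` far l.
Proof.
move=> kl x [Ax xk]; split=> // y /xk; apply: le_trans.
by rewrite lef_pV2 ?posrE// ler_nat.
Qed.

(** A point of [layer i] is at distance at least [1 / (i + 2)] from every point of [C], while a
    point of [layer j] is within [1 / (j + 1) <= 1 / (i + 3)] of some point of [C]; the triangle
    inequality through that point leaves the gap. *)
Let layers_separated i j : (i.+2 <= j)%N -> forall a b, layer i a -> layer j b ->
  ((i.+2%:R^-1 - i.+3%:R^-1 : R) <= mdist a b)%R.
Proof.
move=> ij a b [[_ ai] _] [[Ab _]] /not_andP[//|/existsNP[y /not_implyP[Cy]]].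
move/negP; rewrite -ltNge => bj.
have {}ai := ai y Cy.
have : (mdist b y < i.+3%:R^-1 :> R)%R.
  by apply: lt_le_trans bj _; rewrite lef_pV2 ?posrE// ler_nat.
have := metric_triangle a b y; move: ai => /=.
move: (i.+2%:R^-1)%R (i.+3%:R^-1)%R => u v; lra.
Qed.

Let gap_gt0 i : (0 < i.+2%:R^-1 - i.+3%:R^-1 :> R)%R.
Proof. by rewrite subr_gt0 ltf_pV2 ?posrE// ltr_nat. Qed.

(** Here [b] selects a parity: layers whose indices differ by at least 2 are at positive distance,
    so [mu] adds up over them. *)
Let sum_alternate_layers b n :
  \sum_(0 <= k < n) mu (layer (k.*2 + b)%N) <=
  mu (\bigcup_(k in `I_n) layer (k.*2 + b)%N).
Proof.
elim: n => [|n ih]; first by rewrite big_geq// outer_measure_ge0.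
rewrite big_nat_recr//=; apply: le_trans (leeD2r _ ih) _.
rewrite [leRHS](_ : _ = mu ((\bigcup_(k in `I_n) layer (k.*2 + b)%N) `|`
    layer (n.*2 + b)%N)); last first.
  by rewrite IIS bigcup_setU bigcup_set1.
have [->|n0] := posnP n.
  by rewrite II0 bigcup_set0 outer_measure0 add0e set0U.
(* The gap [1 / ((i + 2) (i + 3))] decreases in [i], so the gap after [m], the last layer already in
   the union, serves for all of them. *)
pose m := (n.-1.*2 + b)%N.
apply: (mu_metric (r := (m.+2%:R^-1 - m.+3%:R^-1)%R)) => // x y [k /= kn lx] ly.
apply: le_trans (layers_separated _ lx ly).
  rewrite -[leRHS]/((_ ^-1 - _^-1))%R.
  have kr l : (l.+2%:R^-1 - l.+3%:R^-1 = (l.+2 * l.+3)%:R^-1 :> R)%R.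
    have a0 : (0 < l.+2%:R :> R)%R by [].
    rewrite natrM -[(l.+3%:R)%R]natr1; field.
    by rewrite !gt_eqF// addr_gt0.
  rewrite !kr lef_pV2 ?posrE ?ltr0n// ler_nat leq_mul// !ltnS /m; lia.
by lia.
Qed.

Let sum_alternate_le b : \sum_(0 <= k <oo) mu (layer (k.*2 + b)%N) <= mu A.
Proof.
apply: lime_le; first by apply: is_cvg_nneseries => *; exact: outer_measure_ge0.
apply: nearW => n; apply: le_trans (sum_alternate_layers b n) _.
by apply: le_outer_measure => x [k _ [[]]].
Qed.

Let sum_layers_le : \sum_(0 <= k <oo) mu (layer k) <= mu A + mu A.
Proof.
apply: lime_le; first by apply: is_cvg_nneseries => *; exact: outer_measure_ge0.
apply: nearW => n.
apply: le_trans (leeD (sum_alternate_le 0) (sum_alternate_le 1)).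
apply: le_trans (leeD (nneseries_lim_ge n _) (nneseries_lim_ge n _));
  try by move=> *; exact: outer_measure_ge0.
rewrite !big_mkord -big_split/=.
rewrite [leRHS](_ : _ = \sum_(k < n.*2) mu (layer k)); last first.
  elim: n => [|n ih]; first by rewrite !big_ord0.
  by rewrite big_ord_recr/= ih doubleS !big_ord_recr/= addn0 addn1 addeA.
have nn : (n <= n.*2)%N by rewrite -addnn leq_addr.
rewrite -!(big_mkord xpredT (fun k => mu (layer k))) (big_cat_nat _ nn)//=.
by rewrite leeDl// sume_ge0// => *; exact: outer_measure_ge0.
Qed.

Let diff_layers k : A `\` C `<=` far k `|` \bigcup_(i in ~` `I_k) layer i.
Proof.
move=> x [Ax Cx]; have [xk|xk] := pselect (far k x); [by left|right].
have [r r0 xr] := C_separated Cx.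
have [N xN] : exists N, far N x.
  exists (Num.truncn r^-1); split=> // y /xr; apply: le_trans.
  by rewrite invf_ple ?posrE// ltW// truncnS_gt.
have /(ex_minnP)[m fm mP] : exists m, `[< far m x >] by exists N; apply/asboolP.
move/asboolP: fm => fm.
have km : (k < m)%N.
  by rewrite ltnNge; apply/negP => mk; apply: xk; exact: far_homo fm.
case: m fm mP km => // m fm mP km.
exists m; first by move: km; rewrite ltnS leqNgt /= => /negP.
by split=> // /asboolP/mP; rewrite ltnn.
Qed.

(** Additivity holds for [far k] in place of [A] minus [C], and the part lost is covered by the
    layers from [k] on. Their measures form a convergent series, bounded by [2 mu A] by splitting
    into even and odd indices, so its tail tends to 0. *)
Lemma metric_caratheodory_le : mu (A `&` C) + mu (A `&` ~` C) <= mu A.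
Proof.
have [->|Afin] := eqVneq (mu A) +oo; first by rewrite leey.
have {}Afin : mu A < +oo by rewrite ltey.
have far_le k : mu (A `&` C) + mu (far k) <= mu A.
  apply: (@le_trans _ _ (mu ((A `&` C) `|` far k))); last first.
    by apply: le_outer_measure => x [] [].
  apply: (mu_metric (r := k.+1%:R^-1%R)) => [|a b [_ Ca] [_ /(_ _ Ca)]].
    by rewrite invr_gt0.
  by rewrite metric_sym.
have tail : \sum_(N <= k <oo) mu (layer k) @[N --> \oo] --> 0.
  apply: nneseries_tail_cvg => [|k _]; last exact: outer_measure_ge0.
  by apply: le_lt_trans sum_layers_le _; rewrite lte_add_pinfty.
apply/lee_addgt0Pr => e e0.
have [N _ /(_ N (leqnn N)) /= tN] : \forall N \near \oo,
    \sum_(N <= k <oo) mu (layer k) < e%:E.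
  by apply: (tail [set y | y < e%:E]); apply: open_ereal_lt'; rewrite lte_fin.
have -> : A `&` ~` C = A `\` C by [].
have : mu (A `\` C) <= mu (far N) + e%:E.
  apply: le_trans (le_outer_measure mu _ _ (@diff_layers N)) _.
  apply: le_trans (outer_measureU2 _ _ _) _.
  rewrite leeD2l//; apply: le_trans (ltW tN).
  exact: outer_measure_sigma_subadditive_tail.
move=> /(leeD2l (mu (A `&` C))) /le_trans; apply.
by rewrite addeA leeD2r.
Qed.

End metric_outer_measure.

Section hausdorff_caratheodory.
Local Open Scope ereal_scope.
Context {R : realType} {T : metricType R}.
Implicit Types (A B : set T) (s d r : R).

Lemma le_hausdorff_content s d d' A : (d' <= d)%R ->
  hausdorff_content s d A <= hausdorff_content s d' A.
Proof.
move=> d'd; apply: ereal_inf_le_tmp => _ [D [F [PF cF ->]]].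
exists D, F; split => // k /PF /= Fk.
by apply: le_trans Fk _; rewrite lee_fin.
Qed.

Lemma mdist_le_diam A x y : A x -> A y -> (mdist x y)%:E <= diam A.
Proof.
move=> Ax Ay; apply: ereal_sup_ubound; right.
by exists (x, y).
Qed.

Lemma diam_ge0 A : 0 <= diam A.
Proof. by apply: ereal_sup_ubound; left. Qed.

Lemma diam_le A (r : \bar R) : 0 <= r ->
  (forall x y, A x -> A y -> (mdist x y)%:E <= r) -> diam A <= r.
Proof.
move=> r0 Ar; apply: ge_ereal_sup => _ [->//|[[x y] /= [Ax Ay] <-]].
exact: Ar.
Qed.

(** A covering set has diameter at most [d < r] and cannot meet both [A] and [B]. Hence the members
    that meet [A] and those that meet [B] are disjoint subfamilies of the cover. *)
Lemma hausdorff_content_separated s d r A B : (d < r)%R ->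
  (forall a b, A a -> B b -> (r <= mdist a b)%R) ->
  hausdorff_content s d A + hausdorff_content s d B <=
  hausdorff_content s d (A `|` B).
Proof.
move=> dr sep; apply: le_ereal_inf_tmp => _ [D [F [PF cF ->]]].
pose DA : set nat := D `&` [set k | F k `&` A !=set0].
pose DB : set nat := D `&` [set k | F k `&` B !=set0].
have contentE X : X `<=` A `|` B -> hausdorff_content s d X <=
    \sum_(0 <= k <oo | k \in D `&` [set k | F k `&` X !=set0]) diam (F k) `^ s.
  move=> XAB; apply: ereal_inf_lbound; exists (D `&` [set k | F k `&` X !=set0]), F.
  split => // [k [Dk _]|x Xx]; first exact: PF.
  have [k Dk Fkx] := cF _ (XAB _ Xx).
  by exists k => //; split => //; exists x.
have := contentE A (@subsetUl _ _ _); have := contentE B (@subsetUr _ _ _).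
move=> hB hA; apply: le_trans (leeD hA hB) _.
rewrite eseries_mkcond [X in _ + X]eseries_mkcond [leRHS]eseries_mkcond.
rewrite -nneseriesD; last 2 first.
- by move=> k _ _; case: ifP => // _; exact: poweR_ge0.
- by move=> k _ _; case: ifP => // _; exact: poweR_ge0.
apply: lee_nneseries => [k _ _|k _].
  by apply: adde_ge0; case: ifP => // _; exact: poweR_ge0.
case: ifPn => [/set_mem[Dk [a [Fa Aa]]]|_]; last first.
  rewrite add0e; case: ifPn => [/set_mem[Dk _]|_]; first by rewrite mem_set.
  by case: ifP => // _; exact: poweR_ge0.
rewrite (mem_set Dk); case: ifPn => [/set_mem[_ [b [Fb Bb]]]|_]; last by rewrite adde0.
have := le_trans (mdist_le_diam Fa Fb) (PF k Dk).
by rewrite lee_fin leNgt (lt_le_trans dr) ?sep.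
Qed.

Lemma hausdorff_measure_metric s : metric_additive (@hausdorff_measure R T s).
Proof.
move=> A B r r0 sep.
set M := hausdorff_measure s (A `|` B).
(* Independent scales [d] and [d'] allow the two suprema to be taken one after the other; both are
   compared with a common scale below [r]. *)
have le2 d d' : (0 < d)%R -> (0 < d')%R ->
    hausdorff_content s d A + hausdorff_content s d' B <= M.
  move=> d0 d'0; pose t := Num.min (Num.min d d') (r / 2)%R.
  have t0 : (0 < t)%R by rewrite !lt_min d0 d'0 divr_gt0.
  apply: le_trans (hausdorff_content_le s (A `|` B) t0).
  apply: (le_trans _ (@hausdorff_content_separated s t r A B _ sep)); last first.
    by rewrite gt_min ltr_pdivrMr// ltr_pMr// ltr1n orbT.
  by apply: leeD; apply: le_hausdorff_content; rewrite !ge_min lexx ?orbT.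
have c0 d X : 0 <= hausdorff_content s d X.
  by apply: cover_outer_measure_ge0 => U _; exact: poweR_ge0.
have [->|Mfin] := eqVneq M +oo; first by rewrite leey.
have {}Mfin : M \is a fin_num by rewrite ge0_fin_numE ?ltey// hausdorff_measure_ge0.
have finB d' : (0 < d')%R -> hausdorff_content s d' B \is a fin_num.
  move=> d'0; rewrite ge0_fin_numE//; apply: (@le_lt_trans _ _ M); last first.
    by rewrite ltey_eq Mfin.
  by apply: le_trans (le2 _ _ ltr01 d'0); rewrite leeDr.
have hA d' : (0 < d')%R -> hausdorff_measure s A <= M - hausdorff_content s d' B.
  by move=> d'0; apply: ge_ereal_sup => _ [d /= d0 <-]; rewrite leeBrDr ?le2 ?finB.
have finA : hausdorff_measure s A \is a fin_num.
  rewrite ge0_fin_numE ?hausdorff_measure_ge0//.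
  apply: le_lt_trans (hA _ ltr01) _.
  by rewrite ltey_eq fin_numB Mfin finB.
rewrite -leeBrDl//; apply: ge_ereal_sup => _ [d' /= d'0 <-].
by rewrite leeBrDl// -leeBrDr ?finB ?hA.
Qed.

Lemma hausdorff_measurable_closed s (C : set T) :
  (forall x, ~ C x -> exists2 r : R, (0 < r)%R &
     forall y, C y -> (r <= mdist x y)%R) ->
  (@hausdorff_measure R T s).-caratheodory C.
Proof.
move=> sepC; apply: le_caratheodory_measurable => A.
exact: (metric_caratheodory_le (@hausdorff_measure_metric s) sepC A).
Qed.

(** This lets an arbitrary set of directions be enlarged to a measurable one. *)
Lemma hausdorff_measurable_nbhd s (A : set T) r :
  (@hausdorff_measure R T s).-caratheodory
    [set x | exists2 a, A a & (mdist a x < r)%R].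
Proof.
rewrite -[X in _.-caratheodory X]setCK.
apply: caratheodory_measurable_setC; apply: hausdorff_measurable_closed => x.
move=> /contrapT [a Aa ax]; exists (r - mdist a x)%R; first by rewrite subr_gt0.
move=> y /forall2NP /(_ a) [//|/negP]; rewrite -leNgt => ay.
by rewrite lerBlDl; apply: le_trans ay _; exact: metric_triangle.
Qed.

End hausdorff_caratheodory.

(** * Lebesgue measure of boxes and tubes *)

Lemma measurable_nneseries {R : realType} d (T : measurableType d) (D : set T)
    (h : nat -> T -> \bar R) :
  (forall k x, D x -> 0 <= h k x)%E -> (forall k, measurable_fun D (h k)) ->
  measurable_fun D (fun x => \sum_(0 <= k <oo) h k x)%E.
Proof.
move=> h0 mh.
exact: (@ge0_emeasurable_sum _ _ _ D h xpredT (fun k x Dx _ => h0 k x Dx)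
  (fun k _ => mh k)).
Qed.

Section box_volume.
Local Open Scope ereal_scope.
Context {R : realType}.
Local Notation mu := (@lebesgue_measure R).

Let cube n (u v : nat -> R) : set (nat -> R) :=
  [set x | forall i, (i < n)%N -> (u i <= x i <= v i)%R].

(* Fubini by hand: freezing the last coordinate absorbs the indicator of the last
   side into the weights, and integrating the result restores the length of that
   side. *)
Lemma weighted_cover_volume n (c : nat -> \bar R) (a b : nat -> nat -> R)
    (lo hi : nat -> R) :
  (forall k, 0 <= c k) ->
  (forall k i, (i < n)%N -> (a k i <= b k i)%R) ->
  (forall i, (i < n)%N -> (lo i <= hi i)%R) ->
  (forall x, cube n lo hi x ->
     1 <= \sum_(0 <= k <oo) c k * (\1_(cube n (a k) (b k)) x)%:E) ->
  (\prod_(i < n) (hi i - lo i))%:E <=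
  \sum_(0 <= k <oo) c k * (\prod_(i < n) (b k i - a k i))%:E.
Proof.
elim: n => [|n ih] in c *.
  move=> c0 _ _ /(_ (fun=> 0%R))/=; rewrite big_ord0 => h.
  apply: le_trans (h _) _ => //; apply: lee_nneseries => [k _ _|k _].
    by rewrite mule_ge0// lee_fin.
  by rewrite big_ord0 lee_wpmul2l// lee_fin indicE; case: (_ \in _).
move=> c0 ab lohi cov.
have ab' k i : (i < n)%N -> (a k i <= b k i)%R by move=> /ltnW; exact: ab.
have V0 k : (0 <= \prod_(i < n) (b k i - a k i))%R.
  by apply: prodr_ge0 => i _; rewrite subr_ge0 ab'.
pose g k (y : R) := c k * (\1_(`[a k n, b k n]%classic) y)%:E *
   (\prod_(i < n) (b k i - a k i))%:E.
have slice y : `[lo n, hi n]%classic y ->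
    (\prod_(i < n) (hi i - lo i))%:E <= \sum_(0 <= k <oo) g k y.
  rewrite /= in_itv/= => yn; apply: ih => //.
  - by move=> k; rewrite mule_ge0// lee_fin.
  - by move=> i /ltnW; exact: lohi.
  - move=> x xn; pose x' i := if i == n then y else x i.
    have /cov h : cube n.+1 lo hi x'.
      move=> i; rewrite ltnS leq_eqVlt /x'; case: eqVneq => [->//|_ /=]; exact: xn.
    apply: (le_trans h); apply: lee_nneseries => [k _ _|k _].
      by rewrite mule_ge0// lee_fin.
    rewrite -muleA -EFinM lee_wpmul2l// lee_fin !indicE.
    case: (boolP (x' \in _)) => [/set_mem xk|//].
    rewrite !mem_set ?mulr1//.
      by move=> i /[dup] /ltn_eqF ii /ltnW/xk; rewrite /x' ii.
    by move: (xk n (ltnSn n)); rewrite /x' eqxx /= in_itv.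
    by move=> _; rewrite mulr_ge0.
have mg k (D : set (measurableTypeR R)) : measurable_fun D (g k).
  apply: measurable_funTS; apply: emeasurable_funM => //.
  apply: emeasurable_funM => //; apply/measurable_EFinP.
  exact: measurable_indic.
have g0 k y : 0 <= g k y by rewrite !mule_ge0// lee_fin.
have nlohi : (lo n <= hi n)%R by apply: lohi.
rewrite big_ord_recr/= EFinM.
have -> : (hi n - lo n)%:E = mu `[lo n, hi n]%classic.
  by rewrite lebesgue_measure_itv/= lte_fin; case: ltgtP nlohi => // ->; rewrite subrr.
rewrite -integral_cst//.
apply: le_trans (_ : \int[mu]_(y in `[lo n, hi n]%classic)
    (\sum_(0 <= k <oo) g k y) <= _).
  apply: ge0_le_integral => //.
  - move=> y _ /=; rewrite lee_fin; apply: prodr_ge0 => i _.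
    by rewrite subr_ge0 lohi//; exact: (ltnW (ltn_ord i)).
  - exact: (measurable_nneseries (fun k y _ => g0 k y) (fun k => mg k _)).
rewrite integral_nneseries//; apply: lee_nneseries => [k _ _|k _].
  by apply: integral_ge0.
rewrite big_ord_recr/= EFinM muleA.
under eq_integral do rewrite /g muleAC.
rewrite ge0_integralZl//; last 2 first.
- by apply/measurable_EFinP; exact: measurable_indic.
- by rewrite mule_ge0// lee_fin.
rewrite lee_wpmul2l// ?mule_ge0// ?lee_fin//.
rewrite integral_indic//.
apply: le_trans (_ : mu `[a k n, b k n]%classic <= _).
  by apply: le_measure; rewrite ?inE//; exact: measurableI.
have := ab k n (ltnSn n); rewrite lebesgue_measure_itv/= lte_fin.
by case: ltgtP => // -> _; rewrite subrr.
Qed.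

End box_volume.

Section lebesgue_box.
Local Open Scope ereal_scope.
Context {R : realType} {n : nat}.
Local Notation E := (euclidean R n).
Implicit Types (x a b : E) (i : 'I_n).
Let mu : set E -> \bar R := @lebesgue_outer R n.

(** Coordinates indexed by [nat], with value 0 beyond [n], as in [weighted_cover_volume], whose
    induction changes the dimension. *)
Let coord x k : R := if insub k is Some i then x ord0 i else 0%R.

Let coordE x i : coord x i = x ord0 i.
Proof. by rewrite /coord valK. Qed.

Lemma lebesgue_outer_box a b : (forall i, a ord0 i <= b ord0 i)%R ->
  mu (box (a, b)) = (\prod_(i < n) (b ord0 i - a ord0 i))%:E.
Proof.
move=> ab; apply/eqP; rewrite eq_le; apply/andP; split.
  apply: ereal_inf_lbound; exists [set 0%N], (fun=> (a, b)); split => //.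
    by move=> x xab; exists 0%N.
  rewrite eseries_mkcond nneseries_recl//; last first.
    move=> k _; case: ifP => // _; rewrite lee_fin.
    by apply: prodr_ge0 => i _; rewrite subr_ge0.
  rewrite mem_set// (@eseries0 _ _ 1)//= ?adde0// => k k1 _.
  by rewrite memNset//= => k0; rewrite k0 in k1.
apply: le_ereal_inf_tmp => _ [D [F [PF cF ->]]].
pose c k : \bar R := if k \in D then 1 else 0.
(* [weighted_cover_volume] wants ordered sides for every index; indices outside [D] get a one-point
   box and carry weight [c k = 0]. *)
have FD k : exists ab' : E * E, (forall i, ab'.1 ord0 i <= ab'.2 ord0 i)%R /\
    (D k -> ab' = F k).
  have [Dk|nDk] := pselect (D k); first by exists (F k); split => //; exact: PF.
  by exists (0%R, 0%R).
have [G PG] := @choice _ _ _ FD.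
rewrite [leLHS](_ : _ = (\prod_(i < n) (coord b i - coord a i))%:E); last first.
  by congr EFin; apply: eq_bigr => i _; rewrite !coordE.
have := @weighted_cover_volume R n c (fun k => coord (G k).1)
  (fun k => coord (G k).2) (coord a) (coord b).
move=> /(_ _ _ _ _)/le_trans; apply.
- by move=> k; rewrite /c; case: ifP.
- by move=> k i lin; rewrite -[i]/(nat_of_ord (Ordinal lin)) !coordE; have [] := PG k.
- by move=> i lin; rewrite -[i]/(nat_of_ord (Ordinal lin)) !coordE.
- move=> x xab; have /cF [k Dk Fkx] : box (a, b) (\row_(i < n) x i).
    by move=> i; rewrite mxE /= -!coordE; exact: xab.
  apply: le_trans (_ : c k * (\1_[set x | forall i : nat, (i < n)%N ->
     (coord (G k).1 i <= x i <= coord (G k).2 i)%R] x)%:E <= _); last first.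
    rewrite (@nneseriesD1 _ _ k)//; last first.
      by move=> l _; rewrite mule_ge0// ?lee_fin// /c; case: ifP.
    rewrite leeDl// nneseries_ge0// => l _ _.
    by rewrite mule_ge0// ?lee_fin// /c; case: ifP.
  rewrite indicE mem_set => [|i lin]; first by rewrite /c mem_set// mul1e lexx.
  have [_ ->//] := PG k; have := Fkx (Ordinal lin).
  by rewrite mxE -(coordE (F k).1) -(coordE (F k).2).
rewrite [leRHS]eseries_mkcond; apply: lee_nneseries => [k _ _|k _].
  rewrite mule_ge0//; first by rewrite /c; case: ifP.
  rewrite lee_fin; apply: prodr_ge0 => i _; rewrite subr_ge0 !coordE.
  by have [] := PG k.
rewrite /c; case: ifPn => [/set_mem Dk|_]; last by rewrite mul0e.
rewrite mul1e lee_fin; have [_ ->//] := PG k.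
by rewrite le_eqVlt; apply/orP; left; apply/eqP; apply: eq_bigr => i _; rewrite !coordE.
Qed.

Let upd x i (c : R) : E := \row_(j < n) if j == i then c else x ord0 j.

Let updE x i c : upd x i c ord0 i = c.
Proof. by rewrite mxE eqxx. Qed.

Let updN x i c j : j != i -> upd x i c ord0 j = x ord0 j.
Proof. by rewrite mxE => /negbTE ->. Qed.

(** The hyperplane [x_i = c] cuts each box of a cover into two boxes whose volumes add up to the
    original one. The hypotheses admit the open and the closed half-space alike. *)
Lemma lebesgue_measurable_half_space i (c : R) (H : set E) :
  (forall x, H x -> x ord0 i <= c)%R -> (forall x, ~ H x -> c <= x ord0 i)%R ->
  (@lebesgue_outer R n).-caratheodory H.
Proof.
move=> Hle Hge; apply: le_caratheodory_measurable => A.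
apply: le_ereal_inf_tmp => _ [D [F [PF cF ->]]].
(* Clamping [c] to the side of the box makes one half degenerate when the hyperplane misses the
   box. *)
pose cut k := Num.max ((F k).1 ord0 i) (Num.min ((F k).2 ord0 i) c).
have cutP k : D k -> ((F k).1 ord0 i <= cut k <= (F k).2 ord0 i)%R.
  by move=> /PF/(_ i) ab; rewrite le_max lexx/= ge_max ab ge_min lexx.
pose lower k : E * E := ((F k).1, upd (F k).2 i (cut k)).
pose upper k : E * E := (upd (F k).1 i (cut k), (F k).2).
have lowP k : D k -> forall j, ((lower k).1 ord0 j <= (lower k).2 ord0 j)%R.
  move=> Dk j; rewrite /lower/=; have [->|ji] := eqVneq j i.
    by rewrite updE; case/andP: (cutP k Dk).
  by rewrite updN//; exact: PF.
have uppP k : D k -> forall j, ((upper k).1 ord0 j <= (upper k).2 ord0 j)%R.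
  move=> Dk j; rewrite /upper/=; have [->|ji] := eqVneq j i.
    by rewrite updE; case/andP: (cutP k Dk).
  by rewrite updN//; exact: PF.
have V0 (ab : E * E) : (forall j, ab.1 ord0 j <= ab.2 ord0 j)%R ->
    0 <= box_volume ab.
  by move=> h; rewrite lee_fin; apply: prodr_ge0 => j _; rewrite subr_ge0.
have volD k : D k -> box_volume (lower k) + box_volume (upper k) = box_volume (F k).
  move=> Dk; rewrite /box_volume -EFinD; congr EFin.
  rewrite (bigD1 i)//= [X in (_ + X)%R](bigD1 i)//= [RHS](bigD1 i)//= !updE.
  rewrite (eq_bigr (fun j => (F k).2 ord0 j - (F k).1 ord0 j)%R); last first.
    by move=> j ji; rewrite updN.
  rewrite [X in (_ + _ * X)%R = _](eq_bigr (fun j => (F k).2 ord0 j - (F k).1 ord0 j)%R); last first.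
    by move=> j ji; rewrite updN.
  by rewrite -mulrDl; congr (_ * _)%R; lra.
apply: le_trans (_ : \sum_(0 <= k <oo | k \in D) box_volume (lower k) +
   \sum_(0 <= k <oo | k \in D) box_volume (upper k) <= _); last first.
  rewrite -nneseriesD; last 2 first.
  - by move=> k _ /set_mem Dk; exact/V0/lowP.
  - by move=> k _ /set_mem Dk; exact/V0/uppP.
  apply: lee_nneseries => [k _ /set_mem Dk|k /set_mem Dk].
    by rewrite adde_ge0//; [exact/V0/lowP|exact/V0/uppP].
  by rewrite volD.
apply: leeD; apply: ereal_inf_lbound.
- exists D, lower; split => // x [Ax Hx]; have [k Dk Fx] := cF x Ax.
  exists k => // j; rewrite /lower/=; have /andP[xa xb] := Fx j.
  rewrite xa/=; have [ji|ji] := eqVneq j i; last by rewrite updN.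
  by rewrite ji updE le_max le_min -ji xb ji Hle ?orbT.
- exists D, upper; split => // x [Ax Hx]; have [k Dk Fx] := cF x Ax.
  exists k => // j; rewrite /upper/=; have /andP[xa xb] := Fx j.
  rewrite xb andbT; have [ji|ji] := eqVneq j i; last by rewrite updN.
  by rewrite ji updE ge_max ge_min -ji xa ji Hge ?orbT.
Qed.

Lemma lebesgue_measurable_box (ab : E * E) :
  (@lebesgue_outer R n).-cara.-measurable (box ab).
Proof.
rewrite (_ : box ab = \bigcap_(i in [set: 'I_n])
    ([set x | x ord0 i <= ab.2 ord0 i]%R `&` ~` [set x | x ord0 i < ab.1 ord0 i]%R)); last first.
  apply/seteqP; split => [x h i _|x h i]/=.
    by have /andP[h1 h2] := h i; split => //; apply/negP; rewrite -leNgt.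
  by have [/= -> /negP] := h i Logic.I; rewrite -leNgt => ->.
apply: fin_bigcap_measurable => // i _; apply: measurableI.
  apply: (@lebesgue_measurable_half_space i (ab.2 ord0 i)) => // x /negP.
  by rewrite -ltNge => /ltW.
apply: measurableC.
apply: (@lebesgue_measurable_half_space i (ab.1 ord0 i)) => x /=; first by move/ltW.
by move/negP; rewrite -leNgt.
Qed.

End lebesgue_box.

(** * Norms, cubes and tubes in Euclidean space *)

Section euclidean_geometry.
Context {R : realType} {n : nat}.
Local Notation E := (euclidean R n).
Implicit Types (x y e : E) (t r : R).

Lemma mdist_enorm x y : mdist x y = enorm (x - y).
Proof. by []. Qed.

Lemma enormZ t x : enorm (t *: x) = `|t| * enorm x.
Proof.
rewrite /enorm -sqrtr_sqr -sqrtrM ?sqr_ge0// mulr_sumr.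
by congr Num.sqrt; apply: eq_bigr => i _; rewrite mxE exprMn.
Qed.

Lemma enorm_ge0 x : 0 <= enorm x.
Proof. exact: sqrtr_ge0. Qed.

Lemma enorm_triangle x y : enorm (x + y) <= enorm x + enorm y.
Proof.
have := metric_triangle (x + y) y 0.
by rewrite !mdist_enorm addrK !subr0.
Qed.

Lemma coord_le_enorm x i : `|x ord0 i| <= enorm x.
Proof.
rewrite -sqrtr_sqr; apply: ler_wsqrtr.
by rewrite (bigD1 i)//= lerDl sumr_ge0// => j _; exact: sqr_ge0.
Qed.

Lemma enorm_le_coord x r : (forall i, `|x ord0 i| <= r) -> enorm x <= n%:R * r.
Proof.
case: n x => [|m] x xr; first by rewrite /enorm big_ord0 sqrtr0 mul0r.
have r0 : 0 <= r by apply: le_trans (xr ord0).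
rewrite -[leRHS]ger0_norm ?mulr_ge0// -sqrtr_sqr; apply: ler_wsqrtr.
apply: (@le_trans _ _ (\sum_(i < m.+1) r ^+ 2)).
  by apply: ler_sum => i _; rewrite -real_normK ?num_real// ler_sqr ?nnegrE.
rewrite sumr_const card_ord -[leLHS]mulr_natl exprMn ler_wpM2r ?sqr_ge0//.
by rewrite -natrX ler_nat expnS leq_pmulr// expn_gt0.
Qed.

(** Otherwise the squares of the coordinates would sum to less than 1. Along such a coordinate a
    segment of direction [e] advances with speed at least [1 / n], which separates its sample
    points. *)
Lemma unit_sphere_coord e : unit_sphere e -> exists i, n%:R^-1 <= `|e ord0 i|.
Proof.
move=> e1; apply: contrapT => /forallNP small.
have {}small i : `|e ord0 i| < n%:R^-1 by rewrite ltNge; apply/negP/small.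
have n0 : (0 < n)%N.
  rewrite lt0n; apply/eqP => n0.
  have e0 : enorm e = 0.
    rewrite /enorm big1 ?sqrtr0// => -[i ltin] _; exfalso.
    by move: ltin; rewrite n0.
  by move: e1; rewrite /unit_sphere/= e0 => /eqP; rewrite eq_sym oner_eq0.
have : enorm e ^+ 2 < 1.
  rewrite sqr_sqrtr ?sumr_ge0// => [|i _]; last exact: sqr_ge0.
  apply: (@lt_le_trans _ _ (\sum_(i < n) (n%:R^-1))); last first.
    by rewrite sumr_const card_ord -[leLHS]mulr_natl divff// pnatr_eq0 -lt0n.
  apply: ltr_sum => [|i _]; first by apply/hasP; exists (Ordinal n0); rewrite ?mem_index_enum.
  rewrite -real_normK ?num_real//.
  apply: (@lt_le_trans _ _ (n%:R^-1 ^+ 2)).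
    by rewrite ltr_sqr ?nnegrE.
  by rewrite expr2 ler_piMl// invf_le1 ?ltr0n// ler1n.
by rewrite e1 expr1n ltxx.
Qed.

Definition cube x r : set E :=
  box (\row_(i < n) (x ord0 i - r) : E, \row_(i < n) (x ord0 i + r) : E).

Lemma cubeP x r y : cube x r y <-> forall i, `|y ord0 i - x ord0 i| <= r.
Proof.
split=> h i; have := h i; rewrite /= !mxE ler_norml.
  by rewrite lerBrDl -lerBlDl => /andP[]; lra.
by move=> /andP[]; lra.
Qed.

Lemma measurable_cube x r : (@lebesgue_outer R n).-cara.-measurable (cube x r).
Proof. exact: lebesgue_measurable_box. Qed.

Lemma lebesgue_cube x r : 0 <= r ->
  lebesgue_outer (cube x r) = ((2 * r) ^+ n)%:E.
Proof.
move=> r0; rewrite lebesgue_outer_box => [|i]; last by rewrite !mxE; lra.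
congr EFin; rewrite -[in RHS](card_ord n) -prodr_const.
by apply: eq_bigr => i _; rewrite !mxE; ring.
Qed.

(** The tube is covered by [N + 1 <= 2 N] cubes of half-side [2 / N] centred at the points
    [x + (p / N) e]: one [1 / N] for the width of the tube, one for rounding the parameter. *)
Lemma lebesgue_tube_le N e x : (0 < N)%N -> unit_sphere e ->
  (lebesgue_outer (tube N%:R^-1 e x) <=
     ((2 * N)%:R * (4 / N%:R) ^+ n)%:E)%E.
Proof.
move=> N0 e1; have N0' : 0 < N%:R :> R by rewrite ltr0n.
pose c p : E := x + (p%:R / N%:R) *: e.
apply: (@le_trans _ _ (lebesgue_outer
    (\big[setU/set0]_(p < N.+1) cube (c p) (2 / N%:R)))).
  apply: le_outer_measure => y [_ [t /= /andP[t0 t1] <-]].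
  rewrite mdist_enorm => yt.
  pose p := Num.truncn (t * N%:R).
  have /andP[pt tp] : p%:R <= t * N%:R < p.+1%:R.
    by apply: truncn_itv; rewrite mulr_ge0.
  have pN : (p <= N)%N.
    by rewrite -(@ler_nat R); apply: le_trans pt _; rewrite ler_piMl.
  rewrite -(bigcup_mkord _ (fun p => cube (c p) (2 / N%:R))); exists p => //=.
  apply/cubeP => i.
  have := le_trans (coord_le_enorm _ i) yt; have := coord_le_enorm e i.
  rewrite e1 !mxE => ei yi.
  apply: (@le_trans _ _ (`|y ord0 i - (x ord0 i + t * e ord0 i)| +
    `|t - p%:R / N%:R| * `|e ord0 i|)).
    rewrite -normrM; apply: le_trans _ (ler_normD _ _).
    by rewrite le_eqVlt; apply/orP; left; apply/eqP; congr (`|_|); ring.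
  have -> : 2 / N%:R = N%:R^-1 + N%:R^-1 * 1 :> R by ring.
  apply: lerD => //; apply: ler_pM => //.
  rewrite ler_norml; apply/andP; split.
    apply: (@le_trans _ _ 0); first by rewrite oppr_le0 invr_ge0 ltW.
    by rewrite subr_ge0 ler_pdivrMr.
  rewrite lerBlDr -[X in X + _]mul1r -mulrDl ler_pdivlMr//.
  by apply/ltW; apply: lt_le_trans tp _; rewrite -natr1 addrC.
apply: (le_trans (outer_measure_subadditive
  [the {outer_measure set E -> \bar R} of @lebesgue_outer R n]
  (fun p => cube (c p) (2 / N%:R)) N.+1)) => /=.
under eq_bigr do rewrite lebesgue_cube ?divr_ge0//.
rewrite sumEFin lee_fin sumr_const card_ord -[leLHS]mulr_natl mulrA.
rewrite (_ : 2 * 2 = 4 :> R)//; last by ring.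
apply: ler_wpM2r; first by rewrite exprn_ge0// divr_ge0.
by rewrite ler_nat; lia.
Qed.

End euclidean_geometry.

(** * A discrete form of the maximal inequality *)

Section lower_integral.
Local Open Scope ereal_scope.
Context d (T : measurableType d) (R : realType) (mu : {measure set T -> \bar R}).

(* No measurability is needed, because the library's integral of a nonnegative
   function is the supremum of the integrals of the simple functions below it. *)
Lemma lower_integral_le (D D' : set T) (f g : T -> \bar R) : D `<=` D' ->
  (forall x, D x -> 0 <= f x) -> (forall x, D' x -> 0 <= g x) ->
  (forall x, D x -> f x <= g x) ->
  \int[mu]_(x in D) f x <= \int[mu]_(x in D') g x.
Proof.
move=> DD' f0 g0 fg; rewrite !ge0_integralE//.
apply: ereal_sup_le => _ [h hf <-]; exists h => // x.
apply: le_trans (hf x) _; rewrite /patch; case: ifPn => [/set_mem Dx|_].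
  by rewrite mem_set ?fg//; exact: DD'.
by case: ifP => // /set_mem; exact: g0.
Qed.

End lower_integral.

Section kakeya_discrete.
Context {R : realType} {n : nat}.
Local Notation E := (euclidean R n).
Implicit Types (x y e : E).
Hypothesis n_gt0 : (0 < n)%N.
Let n0 : n%:R != 0 :> R.
Proof. by rewrite pnatr_eq0 -lt0n. Qed.
Local Notation leb := (@lebesgue_euclidean R n).

Let measurable_cube_weight (k : R) x r : measurable_fun
  [set: caratheodory_type (@lebesgue_outer R n)]
  (fun y => k%:E * (\1_(cube x r) y)%:E)%E.
Proof.
apply: emeasurable_funM; first exact: measurable_cst.
by apply/measurable_EFinP; apply: measurable_indic; exact: measurable_cube.
Qed.

Let cube_weight_ge0 (k : R) x r y : 0 <= k ->
  (0 <= k%:E * (\1_(cube x r) y)%:E)%E.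
Proof. by move=> k0; rewrite -EFinM lee_fin mulr_ge0. Qed.

Let integral_cube_weight (k : R) x r : 0 <= k -> 0 <= r ->
  (\int[leb]_y (k%:E * (\1_(cube x r) y)%:E) = (k * (2 * r) ^+ n)%:E)%E.
Proof.
move=> k0 r0; rewrite ge0_integralZl.
- rewrite integral_indic; [|exact: measurableT|exact: measurable_cube].
  rewrite setIT EFinM; congr (_ * _)%E.
  exact: (@lebesgue_cube R n x r r0).
- exact: measurableT.
- by apply/measurable_EFinP; apply: measurable_indic; exact: measurable_cube.
- by move=> y _; rewrite lee_fin.
- by rewrite lee_fin.
Qed.

Section bush.
Variables (N : nat) (w : nat -> R) (a : nat -> E).
Hypotheses (N_gt0 : (0 < N)%N) (w_ge0 : forall i, 0 <= w i).
Let delta : R := N%:R^-1.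
Let delta_gt0 : 0 < delta. Proof. by rewrite invr_gt0 ltr0n. Qed.
Variable W : R.
Hypothesis W_sum : (\sum_(0 <= i <oo) (w i ^+ n)%:E = W%:E)%E.

Let F y : \bar R :=
  (\sum_(0 <= i <oo) (w i ^+ n)%:E * (\1_(cube (a i) (3 * delta)) y)%:E)%E.

Let term_ge0 i y :
  (0 <= (w i ^+ n)%:E * (\1_(cube (a i) (3 * delta)) y)%:E)%E.
Proof. by apply: cube_weight_ge0; rewrite exprn_ge0. Qed.

Let F_ge0 y : (0 <= F y)%E. Proof. exact: nneseries_ge0. Qed.

Let F_fin y : F y \is a fin_num.
Proof.
rewrite ge0_fin_numE//; apply: (@le_lt_trans _ _ W%:E); last exact: ltry.
rewrite -W_sum; apply: lee_nneseries => [i _ _|i _]; first exact: term_ge0.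
rewrite -EFinM lee_fin indicE; case: (_ \in _); first by rewrite mulr1.
by rewrite mulr0 exprn_ge0.
Qed.

Let f y : R := fine (F y) `^ (n%:R^-1).

Let f_ge0 y : 0 <= f y. Proof. exact: powR_ge0. Qed.

Let f_powR y : f y `^ n%:R = fine (F y).
Proof. by rewrite /f -powRrM mulVf// powRr1// fine_ge0. Qed.

Let measurable_F :
  measurable_fun [set: caratheodory_type (@lebesgue_outer R n)] F.
Proof.
apply: (@measurable_nneseries R _ (caratheodory_type (@lebesgue_outer R n))
  setT) => [i y _|i]; first exact: term_ge0.
exact: measurable_cube_weight.
Qed.

Let measurable_f :
  measurable_fun [set: caratheodory_type (@lebesgue_outer R n)] f.
Proof.
apply: (@measurableT_comp _ _ _ _ _ _ (fun x : R => x `^ (n%:R^-1))).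
  exact: measurable_powR.
exact: measurableT_comp.
Qed.

Let integral_f : (\int[leb]_y `|(f y)%:E| `^ n%:R = ((6 * delta) ^+ n * W)%:E)%E.
Proof.
under eq_integral => y _.
  rewrite gee0_abs ?lee_fin// poweR_EFin f_powR fineK//.
  over.
rewrite (integral_nneseries _ measurableT); last 2 first.
- by move=> i; exact: measurable_cube_weight.
- by move=> i y _; exact: term_ge0.
rewrite EFinM -W_sum -nneseriesZl; last first.
  by move=> i _; rewrite lee_fin exprn_ge0.
apply: eq_eseriesr => i _.
rewrite integral_cube_weight ?exprn_ge0// ?mulr_ge0 ?(ltW delta_gt0)//.
by rewrite -EFinM mulrC; congr ((_ ^+ _ * _)%:E); ring.
Qed.

(** The function is the [n]-th root of the sum of [w i ^ n] times the indicators of the cubes.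
    Summing [n]-th powers gives the exact norm however the cubes overlap, and the [i]-th term alone
    gives the lower bound on the [i]-th cube. *)
Lemma bush_test_function : exists f : E -> R,
  [/\ f \in Lfun leb n%:R%:E,
      ('N[leb]_(n%:R%:E) [EFin \o f] = (((6 * delta) ^+ n * W) `^ n%:R^-1)%:E)%E,
      forall y, 0 <= f y
    & forall i y, cube (a i) (3 * delta) y -> w i <= f y].
Proof.
have normf : ('N[leb]_(n%:R%:E) [EFin \o f] =
    (((6 * delta) ^+ n * W) `^ n%:R^-1)%:E)%E.
  by rewrite unlock /= -poweR_EFin -integral_f.
exists f; split => // [|i y iy].
  apply/andP; split; rewrite inE; first exact: measurable_f.
  by rewrite /= /finite_norm normf ltry.
rewrite -[leLHS](_ : (w i ^+ n) `^ n%:R^-1 = _); last first.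
  by rewrite -powR_mulrn// -powRrM mulfV// powRr1.
apply: ge0_ler_powR; rewrite ?nnegrE ?invr_ge0 ?exprn_ge0 ?fine_ge0//.
rewrite -lee_fin fineK//.
rewrite /F (@nneseriesD1 _ _ i)//.
rewrite (_ : \1_(cube (a i) (3 * delta)) y = 1) ?mule1; last first.
  by rewrite indicE mem_set.
by rewrite leeDl// nneseries_ge0.
Qed.

End bush.

(** The tube contains small disjoint cubes around the points [x + (p / N) e], and [f >= u p] on the
    [p]-th one. Letting [e'] vary near [e] gives the bound on a whole neighbourhood of
    directions. *)
Lemma tube_average_ge (N : nat) (w : nat -> R) (a : nat -> E) (f : E -> R)
    (e e' x : E) (u : nat -> R) (s : R) :
  (0 < N)%N -> unit_sphere e -> unit_sphere e' -> mdist e e' <= (2 * N%:R)^-1 ->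
  (forall y, 0 <= f y) -> (forall i y, cube (a i) (3 * N%:R^-1) y -> w i <= f y) ->
  (forall p, 0 <= u p) -> 0 <= s <= \sum_(p < N.+1) u p ->
  (forall p, (p <= N)%N -> 0 < u p -> exists i, u p <= w i /\
     forall k, `|a i ord0 k - (x + (p%:R / N%:R) *: e) ord0 k| <= 2 * N%:R^-1) ->
  ((s / (2 * (8 * n%:R) ^+ n * N%:R))%:E <=
     kakeya_maximal N%:R^-1 f e')%E.
Proof.
move=> N0 e1 e'1 ee' f0 fw u0 /andP[s0 su] hit.
have N0' : 0 < N%:R :> R by rewrite ltr0n.
have nn0 : 0 < n%:R :> R by rewrite ltr0n.
pose c p : E := x + (p%:R / N%:R) *: e.
(* Since [n rho <= 1 / (2 N)], the other half of the width of the tube absorbs the change from [e]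
   to [e']; since [2 rho < 1 / (n N)], cubes around different sample points are disjoint. *)
pose rho : R := (4 * n%:R * N%:R)^-1.
have rho0 : 0 < rho by rewrite invr_gt0 !mulr_gt0.
pose T := tube N%:R^-1 e' x.
have cubeT p : (p <= N)%N -> cube (c p) rho `<=` T.
  move=> pN y /cubeP yc; exists (x + (p%:R / N%:R) *: e').
    exists (p%:R / N%:R) => //=; rewrite divr_ge0//= ler_pdivrMr// mul1r.
    by rewrite ler_nat.
  rewrite mdist_enorm; apply: (@le_trans _ _ (enorm (y - c p) +
    enorm ((p%:R / N%:R) *: (e - e') : E))).
    apply: le_trans _ (enorm_triangle _ _).
    rewrite le_eqVlt; apply/orP; left; apply/eqP; congr enorm.
    by apply/rowP => i; rewrite !mxE; ring.
  rewrite [leRHS](_ : _ = n%:R * (2 * n%:R * N%:R)^-1 + 1 * (2 * N%:R)^-1); last first.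
    by field; rewrite !gt_eqF.
  apply: lerD.
    apply: enorm_le_coord => i; have := yc i; rewrite !mxE => /le_trans; apply.
    rewrite /rho lef_pV2 ?posrE ?mulr_gt0// !ler_pM2r//; lra.
  rewrite enormZ ger0_norm ?divr_ge0//; apply: ler_pM => //.
  - exact: enorm_ge0.
  - by rewrite ler_pdivrMr// mul1r ler_nat.
have disj p q y : (p <= N)%N -> (q <= N)%N -> cube (c p) rho y ->
    cube (c q) rho y -> p = q.
  move=> pN qN /cubeP yp /cubeP yq; apply: contrapT => /eqP pq.
  have [i ei] := unit_sphere_coord e1.
  have pq1 : 1 <= `|p%:R - q%:R| :> R.
    have /orP[h|h] : (p.+1 <= q)%N || (q.+1 <= p)%N by rewrite -neq_ltn.
      rewrite distrC ger0_norm; last by rewrite subr_ge0 ler_nat ltnW.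
      by rewrite lerBrDr addrC natr1 ler_nat.
    rewrite ger0_norm; last by rewrite subr_ge0 ler_nat ltnW.
    by rewrite lerBrDr addrC natr1 ler_nat.
  have : N%:R^-1 * n%:R^-1 <= rho + rho :> R.
    apply: le_trans (lerD (yq i) (yp i)).
    rewrite [X in _ <= _ + X]distrC; apply: le_trans _ (ler_normD _ _).
    rewrite !mxE (_ : _ + _ = (p%:R - q%:R) * N%:R^-1 * e ord0 i); last by ring.
    rewrite !normrM (gtr0_norm (_ : 0 < N%:R^-1)) ?invr_gt0//.
    apply: ler_pM => //; last by rewrite ler_peMl// invr_ge0.
  rewrite (_ : N%:R^-1 * n%:R^-1 = 4 * rho).
    by move: rho0; lra.
  by rewrite /rho; field; rewrite !gt_eqF.
pose V : R := (2 * rho) ^+ n.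
have V0 : 0 <= V by rewrite exprn_ge0// mulr_ge0// ltW.
have intT : ((V * s)%:E <= \int[leb]_(y in T) `|f y|%:E)%E.
  apply: (@le_trans _ _ (\int[leb]_y
     (\sum_(p < N.+1) (u p)%:E * (\1_(cube (c p) rho) y)%:E)))%E; last first.
    rewrite [leRHS]integral_mkcond; apply: lower_integral_le => // y _.
    - by apply: sume_ge0 => p _; rewrite -EFinM lee_fin mulr_ge0.
    - by rewrite /patch; case: ifP.
    have [[p [pN yp]]|none] := pselect (exists p, (p <= N)%N /\ cube (c p) rho y).
      pose p' : 'I_N.+1 := Ordinal (pN : (p < N.+1)%N).
      rewrite (bigD1 p')//= big1 ?adde0; last first.
        move=> q qp; rewrite indicE memNset ?mule0// => yq.
        move/negP: qp; apply; apply/eqP/val_inj => /=.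
        by apply: (disj _ _ _ _ _ yq yp) => //; rewrite -ltnS.
      rewrite indicE mem_set// mule1 patchE mem_set; last exact: (cubeT p).
      rewrite lee_fin ger0_norm//.
      have := u0 p; rewrite le_eqVlt => /predU1P[<-//|up].
      have [i [uw ai]] := hit p pN up.
      apply: le_trans uw _; apply: fw; apply/cubeP => k.
      have := ai k; rewrite distrC => aik; have /cubeP/(_ k) yk := yp.
      (* One [1 / N] for the half-side [rho] and two for the distance from [a i] to the sample
         point. *)
      have -> : 3 * N%:R^-1 = N%:R^-1 + 2 * N%:R^-1 :> R by ring.
      apply: (@le_trans _ _ (`|y ord0 k - c p ord0 k| + `|c p ord0 k - a i ord0 k|)).
        by apply: le_trans _ (ler_normD _ _); rewrite addrA subrK.
      apply: lerD => //; apply: le_trans yk _.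
      rewrite lef_pV2 ?posrE ?mulr_gt0// ler_peMl ?ltW//.
      have : 1 <= n%:R :> R by rewrite ler1n.
      lra.
    rewrite big1; first by rewrite /patch; case: ifP => // _; rewrite lee_fin.
    move=> q _; rewrite indicE memNset ?mule0// => yq; apply: none.
    by exists q; split => //; rewrite -ltnS.
  rewrite (ge0_integral_sum _ measurableT); last 2 first.
  - by move=> p; exact: measurable_cube_weight.
  - by move=> p y _; exact: cube_weight_ge0.
  rewrite (eq_bigr (fun p : 'I_N.+1 => (u p * V)%:E)).
    by rewrite sumEFin lee_fin -mulr_suml mulrC ler_wpM2r.
  by move=> p _; rewrite integral_cube_weight// ltW.
apply: le_ereal_sup_tmp; exists ((leb T)^-1 * \int[leb]_(y in T) `|f y|%:E)%E.
  by exists x.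
pose B : R := (2 * N)%:R * (4 / N%:R) ^+ n.
have B0 : 0 < B by rewrite mulr_gt0 ?ltr0n ?muln_gt0// exprn_gt0// divr_gt0.
have -> : s / (2 * (8 * n%:R) ^+ n * N%:R) = B^-1 * (V * s).
  rewrite /B /V /rho natrM (_ : 8 * n%:R = (4 / N%:R) / (2 * (4 * n%:R * N%:R)^-1)); last first.
    by field; rewrite !gt_eqF.
  rewrite expr_div_n; move: ((4 / N%:R) ^+ n) ((2 * (4 * n%:R * N%:R)^-1) ^+ n)
    (exprn_gt0 n (divr_gt0 (ltr0n _ 4) N0')) (exprn_gt0 n (mulr_gt0 (ltr0n _ 2) rho0)).
  move=> b v b0 v0; field.
  by rewrite !gt_eqF//.
rewrite EFinM; apply: lee_pmul => //.
- by rewrite lee_fin invr_ge0 ltW.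
- by rewrite lee_fin mulr_ge0.
have -> : (B^-1)%:E = (B%:E^-1)%E by rewrite inver gt_eqF.
have BT : (leb T <= B%:E)%E by exact: lebesgue_tube_le.
have T0 : (0 <= leb T)%E by exact: outer_measure_ge0.
move: (leb T) BT T0 => [r| |] //.
rewrite !lee_fin => rB r0; rewrite !inver (gt_eqF B0).
(* The inverse of a zero measure is [+oo], so that case is trivial. *)
case: eqP => [_|/eqP r_neq0]; first by rewrite leey.
by rewrite lee_fin lef_pV2 ?posrE// lt0r r_neq0.
Qed.

Lemma measurable_unit_sphere (s : R) :
  (@hausdorff_measure R E s).-caratheodory (@unit_sphere R n).
Proof.
apply: hausdorff_measurable_closed => x x1; exists `|enorm x - 1|.
  by rewrite normr_gt0 subr_eq0; exact/eqP.
move=> y y1; rewrite mdist_enorm -y1 ler_norml.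
have := enorm_triangle (x - y) y; have := enorm_triangle (y - x) x.
rewrite !subrK -[enorm (y - x)]/(mdist y x) metric_sym mdist_enorm.
by move=> h1 h2; apply/andP; split; lra.
Qed.

(** The weak-type consequence of the conjecture: Chebyshev's inequality for the maximal function of
    the test function. Segments enter only through [N + 1] sample points, each positive weight [u p]
    being dominated by the weight of a nearby cube. *)
Lemma kakeya_discrete (eps : R) : kakeya_maximal_conjecture R n -> 0 < eps ->
  exists2 C : R, 0 < C & forall (N : nat) (w : nat -> R) (a : nat -> E)
    (A : set E) (s : R),
  (1 < N)%N -> (forall i, 0 <= w i) -> A `<=` @unit_sphere R n -> 0 < s ->
  (forall e, A e -> exists x (u : nat -> R),
    [/\ forall p, 0 <= u p, s <= \sum_(p < N.+1) u p
    & forall p, (p <= N)%N -> 0 < u p -> exists i, u p <= w i /\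
        forall k, `|a i ord0 k - (x + (p%:R / N%:R) *: e) ord0 k| <= 2 * N%:R^-1]) ->
  (hausdorff_measure n.-1%:R A <=
    ((C * N%:R^-1 `^ (- eps) / s) ^+ n)%:E * \sum_(0 <= i <oo) (w i ^+ n)%:E)%E.
Proof.
move=> conj eps0; have [C0 C0P] := conj eps eps0.
(* The constant of the conjecture comes without a sign. *)
pose c1 := Num.max C0 1.
have c10 : 0 < c1 by rewrite lt_max ltr01 orbT.
have nn0 : 0 < n%:R :> R by rewrite ltr0n.
(* Here [12] is the [6] in the norm of the test function times the [2] in the denominator of
   [kappa]; the powers of [N] cancel. *)
exists (c1 * 12 * (8 * n%:R) ^+ n) => [|N w a A s N1 w0 AS s0 hit].
  by rewrite !mulr_gt0// exprn_gt0// mulr_gt0.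
have N0' : 0 < N%:R :> R by rewrite ltr0n ltnW.
pose D := N%:R^-1 `^ (- eps) : R.
have D0 : 0 < D by apply: powR_gt0; rewrite invr_gt0.
have [Woo|Wfin] := eqVneq (\sum_(0 <= i <oo) (w i ^+ n)%:E)%E +oo%E.
  rewrite Woo gt0_muley ?leey// lte_fin exprn_gt0// divr_gt0// !mulr_gt0//.
  by rewrite exprn_gt0// mulr_gt0.
have w0n i : (0 <= (w i ^+ n)%:E)%E by rewrite lee_fin exprn_ge0.
have : (\sum_(0 <= i <oo) (w i ^+ n)%:E)%E \is a fin_num.
  by rewrite ge0_fin_numE ?ltey// nneseries_ge0.
move=> /fineK/esym; set W := fine _ => W_sum; rewrite W_sum.
have W0 : 0 <= W by rewrite -lee_fin -W_sum nneseries_ge0.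
have N0 : (0 < N)%N by exact: ltnW.
have [f [fL fN f0 fw]] := bush_test_function a N0 w0 W_sum.
(* [A] may fail to be measurable. [U] is a measurable set containing it on which the maximal
   function is still at least [kappa]. *)
pose U : set E := @unit_sphere R n `&`
  [set x | exists2 e, A e & mdist e x < (2 * N%:R)^-1].
have mU : (@hausdorff_measure R E n.-1%:R).-caratheodory U.
  apply: caratheodory_measurable_setI; first exact: measurable_unit_sphere.
  exact: hausdorff_measurable_nbhd.
have AU : A `<=` U.
  move=> e Ae; split; first exact: AS.
  by exists e => //; rewrite mdistxx invr_gt0 mulr_gt0.
apply: le_trans (le_hausdorff_measure _ AU) _.
pose kappa := s / (2 * (8 * n%:R) ^+ n * N%:R).
have kappa0 : 0 < kappa.
  by rewrite divr_gt0// !mulr_gt0// exprn_gt0// mulr_gt0.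
have UM e' : U e' -> (kappa%:E <= kakeya_maximal N%:R^-1 f e')%E.
  move=> [e'1 [e Ae ee']]; have [x [u [u0 su hu]]] := hit e Ae.
  apply: (tube_average_ge N0 (AS _ Ae) e'1 (ltW ee') f0 fw u0 _ hu).
  by rewrite (ltW s0).
have delta1 : 0 < (N%:R^-1 : R) < 1.
  by rewrite invr_gt0 N0'/= invf_lt1// ltr1n.
pose q := ((6 * N%:R^-1) ^+ n * W) `^ n%:R^-1.
have q0 : 0 <= q by exact: powR_ge0.
have qn : q ^+ n = (6 * N%:R^-1) ^+ n * W.
  rewrite -powR_mulrn// -powRrM mulVf// powRr1// mulr_ge0// exprn_ge0// mulr_ge0//.
have := C0P _ f delta1 fL; rewrite fN -/D -/q -EFinM.
set I := ('N[_]_(_) [_])%E.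
move=> IC; have {IC} Ir : (I <= (c1 * D * q)%:E)%E.
  by apply: le_trans IC _; rewrite lee_fin ler_wpM2r// ler_wpM2r ?(ltW D0)// le_max lexx.
have : ((kappa ^+ n)%:E * hausdorff_measure n.-1%:R U <= I `^ n%:R)%E.
  rewrite /I Lnorm.unlock -poweRrM mulVf// poweRe1; last first.
    by apply: integral_ge0 => e _; exact: poweR_ge0.
  have -> : ((kappa ^+ n)%:E * hausdorff_measure n.-1%:R U =
     \int[@hausdorff_euclidean R n n.-1%:R]_e
       ((kappa ^+ n)%:E * (\1_U e)%:E))%E.
    rewrite ge0_integralZl.
    - by rewrite integral_indic ?setIT.
    - exact: measurableT.
    - by apply/measurable_EFinP; exact: measurable_indic.
    - by move=> e _; rewrite lee_fin.
    - by rewrite lee_fin exprn_ge0// ltW.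
  apply: lower_integral_le => // e _.
    by rewrite -EFinM lee_fin mulr_ge0// exprn_ge0// ltW.
    exact: poweR_ge0.
  rewrite indicE; case: (boolP (e \in U)) => [/set_mem Ue|_]; last first.
    by rewrite mule0 poweR_ge0.
  rewrite mule1 patchE mem_set; last by case: Ue.
  rewrite -powR_mulrn ?(ltW kappa0)// -poweR_EFin; apply: gt0_ler_poweR.
  - exact: ltW.
  - by rewrite in_itv/= leey andbT lee_fin ltW.
  - by rewrite in_itv/= leey andbT.
  - by apply: le_trans (UM _ Ue) _; exact: lee_abs.
have : (I `^ n%:R <= ((c1 * D * q) `^ n%:R)%:E)%E.
  rewrite -poweR_EFin; apply: gt0_ler_poweR => //.
  - by rewrite in_itv/= leey andbT; exact: Lnorm_ge0.
  - by rewrite in_itv/= leey andbT lee_fin !mulr_ge0// ltW.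
move=> h1 h2; have := le_trans h2 h1.
have kn0 : 0 < kappa ^+ n by rewrite exprn_gt0.
rewrite -lee_pdivlMl// => /le_trans; apply.
rewrite powR_mulrn; last by rewrite !mulr_ge0// ltW.
rewrite -!EFinM lee_fin [(c1 * D * q) ^+ n]exprMn qn le_eqVlt; apply/orP; left; apply/eqP.
rewrite 2!mulrA -exprVn -!exprMn; congr (_ ^+ n * W).
rewrite /kappa -/D; move: ((8 * n%:R) ^+ n) (exprn_gt0 n (mulr_gt0 (ltr0n _ 8) nn0)).
by move=> b b0; field; rewrite !gt_eqF.
Qed.

End kakeya_discrete.

(** * Quasisymmetric maps on segments *)

Section hausdorff_content.
Local Open Scope ereal_scope.
Context {R : realType} {T : metricType R}.
Implicit Types (A : set T) (s d r : R).

Let diam_powR_ge0 s d (U : set T) : diam U <= d%:E -> 0 <= diam U `^ s.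
Proof. by move=> _; exact: poweR_ge0. Qed.

Let content0 s d : hausdorff_content s d (set0 : set T) = 0.
Proof. exact: (cover_outer_measure0 id set0 (@diam_powR_ge0 s d)). Qed.

Let content_ge0 s d A : 0 <= hausdorff_content s d A.
Proof. by apply: cover_outer_measure_ge0; exact: diam_powR_ge0. Qed.

Let content_sub s d :
  {homo (@hausdorff_content R T s d) : A B / A `<=` B >-> A <= B}.
Proof. exact: le_cover_outer_measure. Qed.

Let content_sigma s d : sigma_subadditive (@hausdorff_content R T s d).
Proof.
by apply: cover_outer_measure_sigma_subadditive; exact: diam_powR_ge0.
Qed.

HB.instance Definition _ s d := isOuterMeasure.Build R T
  (@hausdorff_content R T s d) (content0 s d) (@content_ge0 s d)
  (@content_sub s d) (@content_sigma s d).

Lemma hausdorff_content_le_diam s d A : diam A <= d%:E ->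
  hausdorff_content s d A <= diam A `^ s.
Proof.
move=> Ad; apply: ereal_inf_lbound; exists [set 0%N], (fun=> A); split => //.
  by move=> x Ax; exists 0%N.
rewrite eseries_mkcond nneseries_recl//; last first.
  by move=> k _; case: ifP => // _; exact: poweR_ge0.
rewrite mem_set// (@eseries0 _ _ 1)//= ?adde0// => k k1 _.
by rewrite memNset//= => k0; rewrite k0 in k1.
Qed.

(** Supplies the reference point for quasisymmetry at [x]; without it [A] would lie in a ball of
    radius [r / 2]. *)
Lemma diam_half_exists A x r : A x -> (0 <= r)%R -> r%:E < diam A ->
  exists2 y, A y & (r / 2 <= mdist x y)%R.
Proof.
move=> Ax r0 rA; apply: contrapT => /forall2NP near_x.
have {}near_x y : A y -> (mdist x y <= r / 2)%R.
  by move=> Ay; have [//|/negP] := near_x y; rewrite -ltNge => /ltW.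
have : diam A <= r%:E.
  apply: diam_le => [|y z Ay Az]; first by rewrite lee_fin.
  rewrite lee_fin; apply: le_trans (metric_triangle _ x _) _.
  by rewrite (splitr r) lerD ?near_x// metric_sym near_x.
by rewrite leNgt rA.
Qed.

Lemma diam_le_radius A x r : (0 <= r)%R ->
  (forall y, A y -> (mdist x y <= r)%R) -> diam A <= (2 * r)%:E.
Proof.
move=> r0 Ar; apply: diam_le => [|y z Ay Az]; first by rewrite lee_fin mulr_ge0.
rewrite lee_fin; apply: le_trans (metric_triangle _ x _) _.
by rewrite mulrDl mul1r lerD ?Ar// metric_sym Ar.
Qed.

End hausdorff_content.

Section segment.
Context {R : realType} {n : nat}.
Local Notation E := (euclidean R n).
Implicit Types (x e : E) (N p : nat).

Lemma mdist_segment e x (s t : R) : unit_sphere e ->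
  mdist (x + s *: e : E) (x + t *: e) = `|s - t|.
Proof.
move=> e1; rewrite mdist_enorm.
rewrite (_ : _ - _ = (s - t) *: e :> E) ?(@enormZ R n) ?e1 ?mulr1//.
by apply/rowP => i; rewrite !mxE; ring.
Qed.

(** For [p = N] the piece is the end point of the segment alone, which is why indices run up to [N]
    inclusive. *)
Definition subsegment e x N p : set E :=
  [set x + t *: e | t in
    [set t : R | 0 <= t <= 1 /\ p%:R / N%:R <= t <= p.+1%:R / N%:R]].

Lemma subsegment_sub e x N p : subsegment e x N p `<=` unit_segment e x.
Proof. by move=> _ [t [t01 _] <-]; exists t. Qed.

Lemma segment_sub_bigcup e x N y : (0 < N)%N -> unit_segment e x y ->
  exists2 p : nat, (p <= N)%N & subsegment e x N p y.
Proof.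
move=> N0 [t /andP[t0 t1] <-]; have N0' : 0 < N%:R :> R by rewrite ltr0n.
have /andP[pt tp] : (Num.truncn (t * N%:R))%:R <= t * N%:R < (Num.truncn (t * N%:R)).+1%:R.
  by apply: truncn_itv; rewrite mulr_ge0.
exists (Num.truncn (t * N%:R)).
  by rewrite -(@ler_nat R); apply: le_trans pt _; rewrite ler_piMl.
exists t => //; split; first by rewrite t0 t1.
by rewrite ler_pdivrMr// pt ler_pdivlMr// ltW.
Qed.

Lemma mdist_subsegment e x N p y z : (0 < N)%N -> unit_sphere e ->
  subsegment e x N p y -> subsegment e x N p z -> mdist y z <= N%:R^-1.
Proof.
move=> N0 e1 [s [_ /andP[s1 s2]] <-] [t [_ /andP[t1 t2]] <-].
rewrite mdist_segment//; have N0' : 0 < N%:R :> R by rewrite ltr0n.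
move: s2 t2; rewrite -natr1 mulrDl mul1r => s2 t2.
by rewrite ler_norml; apply/andP; split; lra.
Qed.

Lemma mdist_subsegment_left e x N p y : (0 < N)%N -> unit_sphere e ->
  subsegment e x N p y -> mdist y (x + (p%:R / N%:R) *: e) <= N%:R^-1.
Proof.
move=> N0 e1 [s [_ /andP[s1 s2]] <-].
rewrite mdist_segment//; have N0' : 0 < N%:R :> R by rewrite ltr0n.
move: s2; rewrite -natr1 mulrDl mul1r => s2.
have : 0 < N%:R^-1 :> R by rewrite invr_gt0.
by move=> N1; rewrite ler_norml; apply/andP; split; lra.
Qed.

End segment.

Section quasisymmetric_segment.
Context {R : realType} {n : nat} {X : metricType R}.
Local Notation E := (euclidean R n).
Variables (h : E -> X) (K : set E) (eta : R -> R).
Hypotheses (eta_ge0 : forall t, 0 <= t -> 0 <= eta t)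
  (eta_le : forall s t, 0 <= s -> s <= t -> eta s <= eta t)
  (h_qs : forall x y z, K x -> K y -> K z -> x <> z ->
     mdist (h x) (h y) <= eta (mdist x y / mdist x z) * mdist (h x) (h z)).

Lemma qs_le x y z (r : R) : K x -> K y -> K z -> 0 < mdist x z -> 0 <= r ->
  mdist x y <= r * mdist x z -> mdist (h x) (h y) <= eta r * mdist (h x) (h z).
Proof.
move=> Kx Ky Kz xz r0 xy; apply: le_trans (h_qs Kx Ky Kz _) _.
  by move=> xz'; move: xz; rewrite xz' mdistxx ltxx.
apply: ler_wpM2r; first exact: mdist_ge0.
apply: eta_le; first by rewrite divr_ge0// mdist_ge0.
by rewrite ler_pdivrMr.
Qed.

Variables (e x : E).
Hypotheses (e1 : unit_sphere e) (LK : unit_segment e x `<=` K).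
Let D := mdist (h x) (h (x + e : E)).

Let pt (t : R) : E := x + t *: e.

Let ptK t : 0 <= t <= 1 -> K (pt t).
Proof. by move=> t01; apply: LK; exists t. Qed.

Let D_pt : D = mdist (h (pt 0)) (h (pt 1)).
Proof. by rewrite /D /pt scale0r addr0 scale1r. Qed.

(** No point of the segment is farther from [x] than [x + e], so quasisymmetry at [x] applies with
    ratio at most 1; the 2 comes from passing through [h x]. *)
Lemma qs_segment_bound y z : unit_segment e x y -> unit_segment e x z ->
  mdist (h y) (h z) <= 2 * eta 1 * D.
Proof.
move=> Ly Lz.
have bound w : unit_segment e x w -> mdist (h (pt 0)) (h w) <= eta 1 * D.
  move=> [t t01 <-]; rewrite D_pt; apply: qs_le => //.
  - by apply: ptK; rewrite lexx ler01.
  - exact: ptK.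
  - by apply: ptK; rewrite lexx ler01.
  - by rewrite mdist_segment// sub0r normrN normr1.
  - rewrite !mdist_segment// !sub0r !normrN normr1 mul1r.
    by move: t01 => /= /andP[t0 t1]; rewrite ger0_norm.
apply: le_trans (metric_triangle _ (h (pt 0)) _) _.
by rewrite -mulrA mulrDl mul1r lerD ?bound// metric_sym bound.
Qed.

(* Along the segment one can move away from [y] through points whose distances to
   [y] decrease geometrically, and each step contracts the image by [eta (1 / l)]. *)
Lemma qs_segment_holder (l j : nat) y z : (0 < l)%N ->
  unit_segment e x y -> K z -> mdist y z <= ((l ^ j)%:R)^-1 ->
  mdist (h y) (h z) <= eta 2 * (eta l%:R^-1 ^+ j * (2 * eta 1 * D)).
Proof.
move=> l0 Ly Kz yz; have Ky := LK Ly; have [t /andP[t0 t1] yE] := Ly.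
have l0' : 0 < l%:R :> R by rewrite ltr0n.
(* [c] is an end parameter at distance at least [1 / 2] from [t]. The points [q k] below approach
   [y] from that side, and as [q j] is at least half of [l ^ -j] away from [y], [z] is at most twice
   as far; hence [eta 2]. *)
have [c c01 tc] : exists2 c : R, 0 <= c <= 1 & 2^-1 <= `|t - c|.
  have [th|th] := leP 2^-1 t.
    by exists 0; rewrite ?lexx ?ler01// subr0 ger0_norm.
  exists 1; rewrite ?lexx ?ler01// ler0_norm; first by rewrite opprB; lra.
  by rewrite subr_le0.
pose lam k : R := ((l ^ k)%:R)^-1.
have lam_gt0 k : 0 < lam k by rewrite invr_gt0 ltr0n expn_gt0 l0.
have lam_le1 k : lam k <= 1.
  by rewrite invf_le1 ?ltr0n ?ler1n ?expn_gt0 l0.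
pose q k : E := pt (t + (c - t) * lam k).
have Lq k : unit_segment e x (q k).
  exists (t + (c - t) * lam k) => //=.
  move: (lam k) (lam_gt0 k) (lam_le1 k) c01 => u u0 u1 /andP[c0 c1].
  by apply/andP; split; nra.
have yq k : mdist y (q k) = `|t - c| * lam k.
  rewrite -yE mdist_segment// opprD addrA subrr add0r -mulNr opprB normrM.
  by rewrite [X in _ * X]gtr0_norm.
have yq_gt0 k : 0 < mdist y (q k).
  by rewrite yq mulr_gt0//; apply: lt_le_trans tc; rewrite invr_gt0.
have chain k : mdist (h y) (h (q k)) <= eta l%:R^-1 ^+ k * (2 * eta 1 * D).
  elim: k => [|k ih]; first by rewrite expr0 mul1r; exact: qs_segment_bound.
  rewrite exprS -mulrA; apply: le_trans (_ : _ <= eta l%:R^-1 * mdist (h y) (h (q k))) _.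
    apply: qs_le => //; [exact: LK|exact: LK|].
    rewrite !yq mulrCA ler_wpM2l//.
    by rewrite /lam expnS natrM invfM.
  by apply: ler_wpM2l => //; rewrite eta_ge0// invr_ge0 ltW.
apply: le_trans (_ : _ <= eta 2 * mdist (h y) (h (q j))) _.
  apply: qs_le => //; first exact: LK.
  apply: le_trans yz _; rewrite yq mulrA -/(lam j) ler_peMl ?(ltW (lam_gt0 j))//.
  by move: tc; lra.
by apply: ler_wpM2l => //; exact: eta_ge0.
Qed.

End quasisymmetric_segment.

(** Take the least [m] with [l ^ -m < A]; the bound by [1 / l] forces [m >= 2], and [j = m - 2]. *)
Lemma scale_exists {R : realType} (l : nat) (A : \bar R) : (1 < l)%N ->
  (0 < A)%E -> (A <= (l%:R^-1)%:E)%E ->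
  exists j, ((((l ^ j.+2)%:R)^-1)%:E < A /\ A <= (((l ^ j.+1)%:R)^-1)%:E)%E.
Proof.
move=> l1 A0 Al.
have Afin : A \is a fin_num.
  by rewrite ge0_fin_numE ?(ltW A0)//; apply: le_lt_trans Al _; exact: ltry.
rewrite -(fineK Afin) in A0 Al *; move: (fine A) A0 Al => r.
rewrite lte_fin lee_fin => r0 rl.
have : exists j, ((l ^ j)%:R)^-1 < r.
  exists (Num.truncn r^-1).+1; rewrite invf_plt ?posrE//; last first.
    by rewrite ltr0n expn_gt0 ltnW.
  apply: (@lt_le_trans _ _ (Num.truncn r^-1).+1%:R); first exact: truncnS_gt.
  by rewrite ler_nat ltnW// ltn_expl.
move=> /ex_minnP[m mr mmin].
case: m mr mmin => [|[|j]] mr mmin.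
- move: mr; rewrite expn0 invr1 ltNge => /negP; case; apply: le_trans rl _.
  by rewrite invf_le1 ?ltr0n ?ler1n ltnW.
- by move: mr; rewrite expn1 ltNge rl.
- exists j; rewrite lte_fin lee_fin; split => //.
  by rewrite leNgt; apply/negP => /mmin; rewrite ltnn.
Qed.

(** * Sorting a cover by scale along one segment *)

Section multiscale.
Context {R : realType} {n : nat} {X : metricType R}.
Local Notation E := (euclidean R n).
Variables (h : E -> X) (K : set E) (eta : R -> R).
Hypotheses (eta_ge0 : forall t, 0 <= t -> 0 <= eta t)
  (eta_le : forall s t, 0 <= s -> s <= t -> eta s <= eta t)
  (h_qs : forall x y z, K x -> K y -> K z -> x <> z ->
     mdist (h x) (h y) <= eta (mdist x y / mdist x z) * mdist (h x) (h z)).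

Variables (l : nat) (b c M dd : R) (J : set nat) (F : nat -> set X).
Hypotheses (l_gt1 : (1 < l)%N) (b_gt0 : 0 < b) (c_gt0 : 0 < c) (M_ge0 : 0 <= M).
(** [C1] compares the image of a piece with a covering set that meets it, and [C2] is the constant
    of the decay of images along the scales. The summand 1 makes [C2] positive, since [heavy_scale]
    divides by a power of it. *)
Let C1 := 2 * eta (2 * l%:R).
Let C2 := 2 * (eta 2 * (2 * eta 1 * M)) + 1.
Hypotheses (eta_b : eta l%:R^-1 `^ b <= 8^-1)
  (dd_c : C1 * dd < c) (F_dd : forall k, J k -> (diam (F k) <= dd%:E)%E)
  (F_cover : h @` K `<=` \bigcup_(k in J) F k).

Let l0 : 0 < l%:R :> R. Proof. by rewrite ltr0n ltnW. Qed.
Let C1_ge0 : 0 <= C1. Proof. by rewrite mulr_ge0// eta_ge0// mulr_ge0. Qed.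
Let C2_gt0 : 0 < C2.
Proof. by rewrite ltr_wpDl// !mulr_ge0// eta_ge0. Qed.

Let V k : set E := K `&` h @^-1` F k.
Let delta j : R := ((l ^ j.+1)%:R)^-1.
Let delta_gt0 j : 0 < delta j.
Proof. by rewrite invr_gt0 ltr0n expn_gt0 ltnW. Qed.

Definition scale_class j k :=
  [/\ J k, ((delta j.+1)%:E < diam (V k))%E & (diam (V k) <= (delta j)%:E)%E].

Let d k : R := fine (diam (F k)).

Let diamF k : J k -> diam (F k) = (d k)%:E.
Proof.
move=> Jk; rewrite fineK// ge0_fin_numE ?diam_ge0//.
by apply: le_lt_trans (F_dd Jk) _; exact: ltry.
Qed.

Let V_d k y z : J k -> V k y -> V k z -> mdist (h y) (h z) <= d k.
Proof.
move=> Jk [_ Fy] [_ Fz]; rewrite -lee_fin -diamF//; exact: mdist_le_diam.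
Qed.

Let d_dd k : J k -> d k <= dd.
Proof. by move=> Jk; rewrite -lee_fin -diamF//; exact: F_dd. Qed.

Variables (e x : E).
Hypotheses (e1 : unit_sphere e) (LK : unit_segment e x `<=` K).
Let D := mdist (h x) (h (x + e : E)).
Hypotheses (D_c : c <= D) (D_M : D <= M).
Local Notation L := (unit_segment e x).
Local Notation Lp j p := (subsegment e x (l ^ j.+1) p).

Let L0 : L x.
Proof. by exists 0; rewrite /= ?lexx ?ler01// scale0r addr0. Qed.
Let L1 : L (x + e).
Proof. by exists 1; rewrite /= ?lexx ?ler01// scale1r. Qed.

Let l_pow_gt0 j : (0 < l ^ j)%N. Proof. by rewrite expn_gt0 ltnW. Qed.

Let mdist_L y z : L y -> L z -> mdist y z <= 1.
Proof.
move=> [s /andP[s0 s1] <-] [t /andP[t0 t1] <-]; rewrite mdist_segment//.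
by rewrite ler_norml; apply/andP; split; lra.
Qed.

(** [V k] contains a point at distance at least [delta (j + 1) / 2] from [y], and the piece, of
    length at most [delta j], stays within [2 l] times that distance of [y]. *)
Lemma hit_diam_le j k p y : scale_class j k -> V k y -> Lp j p y ->
  (diam (h @` Lp j p) <= (C1 * d k)%:E)%E.
Proof.
move=> [Jk dV _] Vy Ly; have Ky := LK (subsegment_sub Ly).
have [y0 Vy0 yy0] := diam_half_exists Vy (ltW (delta_gt0 _)) dV.
rewrite /C1 -mulrA; apply: (@diam_le_radius _ _ _ (h y)).
  by rewrite mulr_ge0// ?eta_ge0 ?mulr_ge0// fine_ge0// diam_ge0.
move=> _ [z Lz <-]; apply: (@le_trans _ _ (eta (2 * l%:R) * mdist (h y) (h y0))).
  apply: (qs_le eta_le h_qs) => //.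
  - exact: LK (subsegment_sub Lz).
  - by case: Vy0.
  - by apply: lt_le_trans yy0; rewrite divr_gt0.
  - apply: le_trans (mdist_subsegment (l_pow_gt0 _) e1 Ly Lz) _.
    apply: (@le_trans _ _ (2 * l%:R * (delta j.+1 / 2))).
      rewrite /delta [(l ^ j.+2)%N]expnS natrM le_eqVlt; apply/orP; left; apply/eqP.
      by field; rewrite !gt_eqF// ltr0n.
    by apply: ler_wpM2l => //; rewrite mulr_ge0.
by apply: ler_wpM2l; [rewrite eta_ge0// mulr_ge0|exact: V_d].
Qed.

Lemma subsegment_diam_le j p :
  (diam (h @` Lp j p) <= (C2 * eta l%:R^-1 ^+ j.+1)%:E)%E.
Proof.
have q0 : 0 <= eta l%:R^-1 by rewrite eta_ge0// invr_ge0 ltW.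
have [[y Ly]|no] := pselect (exists y, Lp j p y); last first.
  apply: diam_le; first by rewrite lee_fin mulr_ge0 ?exprn_ge0// ltW.
  by move=> ? ? [z Lz]; case: no; exists z.
apply: (@le_trans _ _ (2 * (eta 2 * (eta l%:R^-1 ^+ j.+1 * (2 * eta 1 * D))))%:E).
  apply: (@diam_le_radius _ _ _ (h y)).
    by rewrite !mulr_ge0 ?exprn_ge0 ?eta_ge0 ?mdist_ge0.
  move=> _ [z Lz <-]; apply: (qs_segment_holder eta_ge0 eta_le h_qs e1 LK) => //.
  - exact: ltnW.
  - exact: subsegment_sub Ly.
  - exact: LK (subsegment_sub Lz).
  - exact: mdist_subsegment Ly Lz.
rewrite lee_fin /C2.
have e2 : 0 <= eta 2 by exact: eta_ge0.
have e1' : 0 <= eta 1 by exact: eta_ge0.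
have qj : 0 <= eta l%:R^-1 ^+ j.+1 by rewrite exprn_ge0.
apply: (@le_trans _ _ (2 * (eta 2 * (2 * eta 1 * M)) * eta l%:R^-1 ^+ j.+1)); last first.
  by rewrite ler_wpM2r// lerDl.
rewrite -!mulrA !ler_wpM2l// [leLHS]mulrC -!mulrA !ler_wpM2l//.
by rewrite ler_wpM2r.
Qed.

(** If [V k] were larger, quasisymmetry at [y] would put the image of the whole segment within
    [eta (2 l) dd] of [h y], whence [D <= C1 dd < c]. *)
Let small_diam k y : J k -> V k y -> L y -> (diam (V k) <= (l%:R^-1)%:E)%E.
Proof.
move=> Jk Vy Ly; rewrite leNgt; apply/negP => dV.
have li : 0 < l%:R^-1 :> R by rewrite invr_gt0.
have [y0 Vy0 yy0] := diam_half_exists Vy (ltW li) dV.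
have near z : L z -> mdist (h y) (h z) <= eta (2 * l%:R) * dd.
  move=> Lz; apply: (@le_trans _ _ (eta (2 * l%:R) * mdist (h y) (h y0))).
    apply: (qs_le eta_le h_qs) => //.
    - exact: LK.
    - exact: LK.
    - by case: Vy0.
    - by apply: lt_le_trans yy0; rewrite divr_gt0.
    - apply: le_trans (mdist_L Ly Lz) _.
      apply: (@le_trans _ _ (2 * l%:R * (l%:R^-1 / 2))).
        by rewrite le_eqVlt; apply/orP; left; apply/eqP; field; rewrite gt_eqF.
      by apply: ler_wpM2l => //; rewrite mulr_ge0.
  apply: ler_wpM2l; first by rewrite eta_ge0// mulr_ge0.
  by apply: le_trans (d_dd Jk); exact: V_d.
have : D <= C1 * dd.
  apply: le_trans (metric_triangle _ (h y) _) _.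
  by rewrite /C1 -mulrA mulrDl mul1r lerD// ?near// metric_sym near.
by rewrite leNgt (lt_le_trans dd_c D_c).
Qed.

Definition hit j p := exists k, scale_class j k /\ exists y, V k y /\ Lp j p y.

Definition hit_weight j p : R :=
  if `[< hit j p >] then fine (diam (h @` Lp j p)) `^ (1 + b) else 0.

Lemma hit_weight_ge0 j p : 0 <= hit_weight j p.
Proof. by rewrite /hit_weight; case: ifP => // _; exact: powR_ge0. Qed.

Lemma hit_weight_le j p : 0 < hit_weight j p -> exists k,
  [/\ scale_class j k, hit_weight j p <= (C1 * d k) `^ (1 + b)
  & exists y, V k y /\ Lp j p y].
Proof.
rewrite /hit_weight; case: ifPn => [/asboolP[k [jk [y [Vy Ly]]]] _|]; last by rewrite ltxx.
exists k; split => //; last by exists y.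
have := hit_diam_le jk Vy Ly.
have dL := subsegment_diam_le j p.
have fL : diam (h @` Lp j p) \is a fin_num.
  by rewrite ge0_fin_numE ?diam_ge0//; apply: le_lt_trans dL _; exact: ltry.
rewrite -[X in (X <= _)%E](fineK fL) lee_fin => hd.
apply: ge0_ler_powR; rewrite ?nnegrE ?fine_ge0 ?diam_ge0//.
  by rewrite addr_ge0// ltW.
by rewrite mulr_ge0// fine_ge0// diam_ge0.
Qed.

(* Since a scale [j] piece has image of diameter [O(eta (1 / l) ^ j)], a weight of
   order [4 ^ j] at some scale is needed to make up the content of the image. *)
Lemma heavy_scale : (c%:E <= hausdorff_content (1 + 2 * b) c (h @` L))%E ->
  exists j, c / (2 * C2 `^ b) * 4 ^+ j.+1 <= \sum_(p < (l ^ j.+1).+1) hit_weight j p.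
Proof.
move=> content_c; apply: contrapT => /forallNP light.
have {}light j : \sum_(p < (l ^ j.+1).+1) hit_weight j p <=
    c / (2 * C2 `^ b) * 4 ^+ j.+1.
  by rewrite leNgt; apply/negP => /ltW; exact: light.
pose mu := [the {outer_measure set X -> \bar R} of
  @hausdorff_content R X (1 + 2 * b) c].
(* The sets [V k] of diameter 0 belong to no scale; their images are at most single points and have
   zero content. *)
pose G0 : set X := \bigcup_k [set z | [/\ J k, diam (V k) = 0%E & (h @` V k) z]].
pose G j : set X := \big[setU/set0]_(p < (l ^ j.+1).+1)
  [set z | hit j p /\ (h @` Lp j p) z].
have cov : h @` L `<=` G0 `|` \bigcup_j G j.
  move=> _ [y Ly <-]; have Ky := LK Ly.
  have [k Jk Fy] := F_cover (imageP h Ky).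
  have Vy : V k y by [].
  have [V0|V0] := eqVneq (diam (V k)) 0%E.
    by left; exists k => //; split => //; exists y.
  have Vpos : (0 < diam (V k))%E by rewrite lt_neqAle eq_sym V0 diam_ge0.
  have [j [j1 j2]] := scale_exists l_gt1 Vpos (small_diam Jk Vy Ly).
  right; exists j => //; have [p pN Lpy] := segment_sub_bigcup (l_pow_gt0 j.+1) Ly.
  rewrite /G -(bigcup_mkord _ (fun p => [set z | hit j p /\ (h @` Lp j p) z])).
  exists p => //=; split; last by exists y.
  by exists k; split => //; exists y.
have mu0 : mu G0 = 0%E.
  apply/eqP; rewrite eq_le outer_measure_ge0 andbT.
  apply: le_trans (outer_measure_sigma_subadditive mu _) _.
  rewrite eseries0// => k _ _.
  have [[Jk V0]|no] := pselect (J k /\ diam (V k) = 0%E); last first.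
    rewrite (_ : [set _ | _] = set0) ?outer_measure0// -subset0 => z [Jk V0 _].
    by case: no.
  have d0 : diam [set z | [/\ J k, diam (V k) = 0%E & (h @` V k) z]] = 0%E.
    apply/eqP; rewrite eq_le diam_ge0 andbT; apply: diam_le => //.
    move=> _ _ [_ _ [y Vy <-]] [_ _ [z Vz <-]].
    suff -> : y = z by rewrite mdistxx.
    apply: mdist_positivity; apply/eqP; rewrite eq_le mdist_ge0 andbT.
    by have := mdist_le_diam Vy Vz; rewrite V0 lee_fin.
  apply/eqP; rewrite eq_le outer_measure_ge0 andbT.
  apply: le_trans (hausdorff_content_le_diam _ _) _; first by rewrite d0 lee_fin ltW.
  by rewrite d0 poweR0r// gt_eqF// addr_gt0// mulr_gt0.
(* The decay [8 ^ -(j + 1)] times the assumed bound of order [4 ^ (j + 1)] leaves [2 ^ -(j + 1)],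
   and the constant is set so that the sum over [j] is at most [c / 2]. *)
have muG j : (mu (G j) <= (c / 2 / (2 ^ j.+1)%:R)%:E)%E.
  apply: le_trans (outer_measure_subadditive mu
    (fun p => [set z | hit j p /\ (h @` Lp j p) z]) _) _.
  apply: (@le_trans _ _ (\sum_(p < (l ^ j.+1).+1)
      (C2 `^ b * 8^-1 ^+ j.+1 * hit_weight j p)%:E)%E).
    apply: lee_sum => p _; rewrite /hit_weight; case: ifPn => [/asboolP hp|/asboolP hp].
      rewrite (_ : [set _ | _] = h @` Lp j p); last by apply/seteqP; split=> [z []//|z Lz]; split.
      have dL := subsegment_diam_le j p.
      have fL : diam (h @` Lp j p) \is a fin_num.
        by rewrite ge0_fin_numE ?diam_ge0//; apply: le_lt_trans dL _; exact: ltry.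
      have [k [jk [y [Vy Ly]]]] := hp.
      have dLc : (diam (h @` Lp j p) <= c%:E)%E.
        apply: le_trans (hit_diam_le jk Vy Ly) _; rewrite lee_fin.
        apply: le_trans (ltW dd_c); apply: ler_wpM2l => //; apply: d_dd.
        by case: jk.
      apply: le_trans (hausdorff_content_le_diam _ dLc) _.
      rewrite -(fineK fL) lee_fin in dL.
      rewrite -[X in (X `^ _)%E](fineK fL) poweR_EFin lee_fin.
      have := fine_ge0 (diam_ge0 (h @` Lp j p)); move: (fine _) dL => t dL t0.
      (* The first factor is the weight; the second is at most [C2 ^ b 8 ^ -(j + 1)] by
         [subsegment_diam_le] and [eta_b]. *)
      have -> : 1 + 2 * b = (1 + b) + b by ring.
      rewrite powRD; last by rewrite gt_eqF// ?implybT// !addr_gt0.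
      rewrite [leLHS]mulrC ler_wpM2r ?powR_ge0//.
      have q0 : 0 <= eta l%:R^-1 by rewrite eta_ge0// invr_ge0 ltW.
      apply: (@le_trans _ _ ((C2 * eta l%:R^-1 ^+ j.+1) `^ b)).
        apply: ge0_ler_powR; rewrite ?nnegrE ?(ltW b_gt0)//.
        by rewrite mulr_ge0 ?exprn_ge0 ?(ltW C2_gt0).
      rewrite powRM ?exprn_ge0 ?(ltW C2_gt0)//.
      rewrite -powR_mulrn// powRAC powR_mulrn ?powR_ge0// ler_wpM2l ?powR_ge0//.
      by apply: lerXn2r; rewrite ?nnegrE ?powR_ge0.
    rewrite mulr0 (_ : [set _ | _] = set0) ?outer_measure0//.
    by rewrite -subset0 => z [].
  rewrite sumEFin lee_fin -mulr_sumr; apply: le_trans (ler_wpM2l _ (light j)) _.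
    by rewrite mulr_ge0 ?powR_ge0.
  rewrite natrX le_eqVlt; apply/orP; left; apply/eqP.
  have p0 : C2 `^ b != 0 by rewrite gt_eqF// powR_gt0.
  rewrite exprVn (_ : 8 = 4 * 2)%R; last by ring.
  rewrite exprMn; field.
  by rewrite p0 !expf_neq0.
have : (mu (h @` L) <= (c / 2)%:E)%E.
  apply: le_trans (le_outer_measure mu _ _ cov) _.
  apply: le_trans (outer_measureU2 mu _ _) _.
  rewrite [X in (X + _)%E]mu0 add0e.
  apply: le_trans (outer_measure_sigma_subadditive mu _) _.
  apply: le_trans (epsilon_trick0 xpredT _); last by rewrite divr_ge0// ltW.
  by apply: lee_nneseries => // k _ _; exact: outer_measure_ge0.
move=> /(le_trans content_c); rewrite lee_fin leNgt ltr_pdivrMr// ltr_pMr//.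
by rewrite ltr1n.
Qed.

End multiscale.

(** * Exceptional directions *)

(** Some [s' < s] has zero [s']-measure, and for diameters at most 1 raising the exponent to [s]
    only decreases the sum. *)
Lemma cover_of_dim {R : realType} {X : metricType R} (B : set X) (s dd tau : R) :
  (hausdorff_dim B < s%:E)%E ->
  0 < dd <= 1 -> 0 < tau ->
  exists (J : set nat) (F : nat -> set X),
  [/\ forall k, J k -> (diam (F k) <= dd%:E)%E, B `<=` \bigcup_(k in J) F k
  & (\sum_(0 <= k <oo | k \in J) (fine (diam (F k)) `^ s)%:E <= tau%:E)%E].
Proof.
move=> /ereal_inf_lt[_ [s' [s'0 Hs'] <-]]; rewrite lte_fin => s's /andP[dd0 dd1] tau0.
have : (hausdorff_content s' dd B < tau%:E)%E.
  by apply: le_lt_trans (hausdorff_content_le _ _ dd0) _; rewrite Hs' lte_fin.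
move=> /ereal_inf_lt[_ [J [F [JF cF ->]]] lt_tau]; exists J, F; split => //.
apply: le_trans (ltW lt_tau); apply: lee_nneseries => [k _ _|k /set_mem Jk].
  by rewrite lee_fin powR_ge0.
have dF : (diam (F k) <= dd%:E)%E := JF k Jk.
have fF : diam (F k) \is a fin_num.
  by rewrite ge0_fin_numE ?diam_ge0//; apply: le_lt_trans dF _; exact: ltry.
rewrite -[X in (_ <= X `^ _)%E](fineK fF) poweR_EFin lee_fin.
have := fine_ge0 (diam_ge0 (F k)); rewrite le_eqVlt => /predU1P[<-|d0].
  (* A set of diameter 0 is treated apart: [0 ^ s = 0] because [s > s' >= 0]. *)
  by rewrite powR0 ?powR_ge0// gt_eqF// (le_lt_trans s'0).
apply: ger_powR (ltW s's); rewrite d0/=.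
by move: dF; rewrite -{1}(fineK fF) lee_fin => /le_trans; apply.
Qed.

Section exceptional_directions.
Context {R : realType} {n : nat} {X : metricType R}.
Local Notation E := (euclidean R n).
Variables (h : E -> X) (K : set E) (eta : R -> R).
Hypotheses (eta_ge0 : forall t, 0 <= t -> 0 <= eta t)
  (eta_le : forall s t, 0 <= s -> s <= t -> eta s <= eta t)
  (eta_small : forall q, 0 < q -> exists2 t, 0 < t & eta t <= q)
  (h_qs : forall x y z, K x -> K y -> K z -> x <> z ->
     mdist (h x) (h y) <= eta (mdist x y / mdist x z) * mdist (h x) (h z)).

Lemma eta_small_powR (b : R) : 0 < b ->
  exists2 l : nat, (1 < l)%N & eta l%:R^-1 `^ b <= 8^-1.
Proof.
move=> b0; have q0 : 0 < (8^-1 : R) `^ b^-1 by apply: powR_gt0; rewrite invr_gt0.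
have [t t0 tq] := eta_small q0.
exists (maxn 2 (Num.truncn t^-1).+1); first by rewrite leq_max.
set l := maxn _ _; have l0 : 0 < l%:R :> R by rewrite ltr0n leq_max.
have lt : l%:R^-1 <= t.
  rewrite invf_ple ?posrE//; apply: le_trans (ltW (truncnS_gt _)) _.
  by rewrite ler_nat leq_maxr.
apply: (@le_trans _ _ (((8^-1 : R) `^ b^-1) `^ b)).
  apply: ge0_ler_powR; rewrite ?nnegrE ?(ltW b0) ?powR_ge0//.
    by rewrite eta_ge0// invr_ge0 ltW.
  by apply: le_trans tq; apply: eta_le => //; rewrite invr_ge0 ltW.
by rewrite -powRrM mulVf ?gt_eqF// powRr1// invr_ge0.
Qed.

Hypotheses (n_gt0 : (0 < n)%N) (conj : kakeya_maximal_conjecture R n)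
  (dimX : (hausdorff_dim [set: X] <= n%:R%:E)%E).

(** Fixing [c] and [M] makes all constants uniform in [e] and [x], so that one cover of [X] serves
    all segments; countably many such sets will exhaust the exceptional directions. *)
Lemma exceptional_directions_null (b c M : R) : 0 < b -> 0 < c -> 0 <= M ->
  hausdorff_measure n.-1%:R
    [set e : E | unit_sphere e /\ exists x : E,
      [/\ unit_segment e x `<=` K, c <= mdist (h x) (h (x + e : E)) <= M
      & (c%:E <= hausdorff_content (1 + 2 * b) c (h @` unit_segment e x))%E]] = 0%E.
Proof.
move=> b0 c0 M0; set T := [set e | _].
have [l l1 lb] := eta_small_powR b0.
have l0 : 1 < l%:R :> R by rewrite ltr1n.
have lgt0 : 0 < l%:R :> R by apply: lt_trans l0.
(* Chosen so that the loss [delta ^ -eps] at [delta = l ^ -j] is exactly [2 ^ j], to be beaten by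
   the gain [4 ^ j]. *)
pose eps : R := ln 2 / ln l%:R.
have eps0 : 0 < eps by rewrite divr_gt0// ln_gt0// ltr1n.
have l_eps j : (l ^ j)%:R^-1 `^ (- eps) = 2 ^+ j :> R.
  rewrite -powR_inv1 ?ler0n// -powRrM mulN1r opprK natrX.
  rewrite -[l%:R ^+ j]powR_mulrn ?ler0n//.
  rewrite powRAC powR_mulrn ?powR_ge0//; congr (_ ^+ _).
  rewrite /powR gt_eqF// /eps mulfVK ?lnK ?posrE//.
  by rewrite gt_eqF// ln_gt0.
have [C C0 CP] := kakeya_discrete n_gt0 conj eps0.
pose C1 := 2 * eta (2 * l%:R).
have C10 : 0 <= C1 by rewrite mulr_ge0// eta_ge0// mulr_ge0// ltW.
pose kap := c / (2 * (2 * (eta 2 * (2 * eta 1 * M)) + 1) `^ b).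
have kap0 : 0 < kap.
  rewrite divr_gt0// mulr_gt0//; apply: powR_gt0.
  by rewrite ltr_wpDl// !mulr_ge0// eta_ge0.
(* The [n]-th power of a weight of exponent [1 + b] has exponent [s]. *)
pose s : R := (1 + b) * n%:R.
have ns : n%:R < s by rewrite /s mulrDl mul1r ltrDl mulr_gt0// ltr0n.
pose Q := (C / kap) ^+ n * C1 `^ s.
have Q0 : 0 <= Q by rewrite mulr_ge0 ?powR_ge0// exprn_ge0// divr_ge0// ltW.
suff bound tau : 0 < tau -> (hausdorff_measure n.-1%:R T <= (Q * tau)%:E)%E.
  apply/eqP; rewrite eq_le hausdorff_measure_ge0 andbT.
  apply/lee_addgt0Pr => r r0; rewrite add0e.
  apply: le_trans (bound (r / (Q + 1)) _) _; first by rewrite divr_gt0// ltr_wpDl.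
  rewrite lee_fin mulrCA ler_piMr ?(ltW r0)// ler_pdivrMr ?mul1r ?lerDl//.
  by rewrite ltr_wpDl.
(* The bound 1 is for [cover_of_dim], and the other term gives [C1 dd < c]. *)
move=> tau0; pose dd := Num.min 1 (c / (C1 + 1)).
have dd0 : 0 < dd by rewrite lt_min ltr01 divr_gt0// ltr_wpDl.
have dd_c : C1 * dd < c.
  apply: (@le_lt_trans _ _ (C1 * (c / (C1 + 1)))).
    by rewrite ler_wpM2l// ge_min lexx orbT.
  rewrite mulrCA gtr_pMr// ltr_pdivrMr ?mul1r ?ltrDl//.
  by rewrite ltr_wpDl.
have dims : (hausdorff_dim [set: X] < s%:E)%E by apply: le_lt_trans dimX _; rewrite lte_fin.
have dd01 : 0 < dd <= 1 by rewrite dd0 ge_min lexx.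
have [J [F [F_dd F_cover F_tau]]] := cover_of_dim dims dd01 tau0.
have hF_cover : h @` K `<=` \bigcup_(k in J) F k by move=> y _; exact: F_cover.
pose A j := [set e : E | unit_sphere e /\ exists x : E,
  [/\ unit_segment e x `<=` K, mdist (h x) (h (x + e : E)) <= M
  & kap * 4 ^+ j.+1 <= \sum_(p < (l ^ j.+1).+1) hit_weight h K l b J F e x j p]].
have TA : T `<=` \bigcup_j A j.
  move=> e [e1 [x [LK /andP[Dc DM] ce]]].
  have [j hj] := heavy_scale eta_ge0 eta_le h_qs l1 b0 c0 M0 lb dd_c F_dd hF_cover
    e1 LK Dc DM ce.
  by exists j => //; split => //; exists x.
pose w j k : R := if `[< scale_class h K l J F j k >]
  then (C1 * fine (diam (F k))) `^ (1 + b) else 0.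
have w0 j k : 0 <= w j k by rewrite /w; case: ifP => // _; exact: powR_ge0.
have sum_w j : (\sum_(0 <= k <oo) (w j k ^+ n)%:E <= (C1 `^ s * tau)%:E)%E.
  rewrite EFinM; apply: le_trans (lee_wpmul2l _ F_tau); last by rewrite lee_fin powR_ge0.
  rewrite -nneseriesZl; last by move=> k _; rewrite lee_fin powR_ge0.
  rewrite [leRHS]eseries_mkcond.
  apply: lee_nneseries => [k _ _|k _]; first by rewrite lee_fin exprn_ge0.
  rewrite /w; case: ifPn => [/asboolP[Jk _ _]|_]; last first.
    rewrite expr0n gtn_eqF//; case: ifP => // _.
    by rewrite -EFinM lee_fin mulr_ge0 ?powR_ge0.
  rewrite mem_set// -EFinM lee_fin -powR_mulrn ?powR_ge0// -powRrM -/s.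
  by rewrite powRM// fine_ge0// diam_ge0.
(* Any point of [V k] serves as centre; the default 0 occurs only for empty [V k], which no piece
   hits. *)
pose a k : E := xget 0 (K `&` h @^-1` F k).
have muA j : (hausdorff_measure n.-1%:R (A j) <= (Q * tau / (2 ^ j.+1)%:R)%:E)%E.
  have Nj : (1 < l ^ j.+1)%N by rewrite -(expn0 l) ltn_exp2l.
  have Nj0 : (0 < l ^ j.+1)%N by exact: ltnW.
  have s4 : 0 < kap * 4 ^+ j.+1 by rewrite mulr_gt0// exprn_gt0.
  have /le_trans -> // : (hausdorff_measure n.-1%:R (A j) <=
      ((C * (l ^ j.+1)%:R^-1 `^ (- eps) / (kap * 4 ^+ j.+1)) ^+ n)%:E *
      \sum_(0 <= k <oo) (w j k ^+ n)%:E)%E.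
    apply: (CP _ (w j) a _ _ Nj (w0 j) _ s4) => [e []//|e [e1 [x [LK DM heavy]]]].
    exists x, (hit_weight h K l b J F e x j); split => // [p|p pN up].
      exact: hit_weight_ge0.
    have [k [jk uk [y [Vy Ly]]]] :=
      hit_weight_le eta_ge0 eta_le h_qs l1 b0 M0 F_dd e1 LK DM up.
    exists k; split => [|i].
      by apply: le_trans uk _; rewrite /w; case: ifPn => // /asboolP.
    have Va : (K `&` h @^-1` F k) (a k) by exact: (@xgetPex _ 0 _ (ex_intro _ y Vy)).
    have ay : mdist (a k) y <= (l ^ j.+1)%:R^-1.
      have [_ _ dV] := jk; rewrite -lee_fin; apply: le_trans dV.
      exact: mdist_le_diam.
    have yx := mdist_subsegment_left Nj0 e1 Ly.
    have := coord_le_enorm (a k - (x + (p%:R / (l ^ j.+1)%:R) *: e) : E) i.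
    rewrite !mxE => /le_trans; apply.
    rewrite -mdist_enorm; apply: le_trans (metric_triangle _ y _) _.
    by rewrite mulrDl mul1r lerD.
  rewrite l_eps; apply: le_trans (lee_wpmul2l _ (sum_w j)) _.
    by rewrite lee_fin exprn_ge0// divr_ge0// ?(ltW s4)// mulr_ge0 ?(ltW C0)// exprn_ge0.
  rewrite -EFinM lee_fin natrX.
  (* What is left of loss and gain is [2 ^ -(j + 1)]; its [n]-th power is at most itself as
     [n >= 1], and this is summable in [j]. *)
  have -> : C * 2 ^+ j.+1 / (kap * 4 ^+ j.+1) = C / kap * (2 ^+ j.+1)^-1.
    rewrite (_ : 4 = 2 * 2 :> R); last by ring.
    rewrite exprMn; field; rewrite (gt_eqF kap0)/=.
    by rewrite expf_neq0.
  rewrite exprMn /Q mulrA [leLHS]mulrAC -[leLHS]mulrA -[X in _ <= X]mulrA.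
  rewrite [leRHS](_ : _ = (C / kap) ^+ n * C1 `^ s * tau * (2 ^+ j.+1)^-1); last by ring.
  rewrite [leLHS](_ : _ = (C / kap) ^+ n * C1 `^ s * tau * (2 ^+ j.+1)^-1 ^+ n); last by ring.
  apply: ler_wpM2l; first by rewrite mulr_ge0// ltW.
  rewrite -[leRHS]expr1 ler_wiXn2l// ?invr_ge0 ?exprn_ge0//.
  by rewrite invf_le1 ?exprn_gt0// exprn_ege1// ler1n.
apply: le_trans (le_hausdorff_measure _ TA) _.
apply: le_trans (hausdorff_measure_sigma_subadditive _ _) _.
apply: le_trans (epsilon_trick0 xpredT _); last by rewrite mulr_ge0// ltW.
by apply: lee_nneseries => // k _ _; exact: hausdorff_measure_ge0.
Qed.

End exceptional_directions.

(** * Lower bound for the dimension *)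

Section dimension_lower_bound.
Context {R : realType} {n : nat} {X : metricType R}.
Local Notation E := (euclidean R n).
Variables (h : E -> X) (K : set E) (eta : R -> R).
Hypotheses (eta_ge0 : forall t, 0 <= t -> 0 <= eta t)
  (eta_le : forall s t, 0 <= s -> s <= t -> eta s <= eta t)
  (eta_small : forall q, 0 < q -> exists2 t, 0 < t & eta t <= q)
  (h_qs : forall x y z, K x -> K y -> K z -> x <> z ->
     mdist (h x) (h y) <= eta (mdist x y / mdist x z) * mdist (h x) (h z)).
Variables (e x : E).
Hypotheses (e1 : unit_sphere e) (LK : unit_segment e x `<=` K).
Let D := mdist (h x) (h (x + e : E)).
Hypothesis D_gt0 : 0 < D.

(** Extends the parametrization of the segment to the whole line, so that [phi] is continuous on all
    of [R]. *)
Let clamp (t : R) : R := Num.max 0 (Num.min 1 t).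

Let clamp01 t : 0 <= clamp t <= 1.
Proof. by rewrite /clamp le_max lexx/= ge_max ler01 ge_min lexx. Qed.

Let clamp_id t : 0 <= t <= 1 -> clamp t = t.
Proof. by move=> /andP[t0 t1]; rewrite /clamp (min_idPr t1) (max_idPr t0). Qed.

Let clamp_lipschitz s t : `|clamp s - clamp t| <= `|s - t|.
Proof.
have key u v : clamp u - clamp v <= `|u - v|.
  have := ler_norm (u - v); have := normr_ge0 (u - v); rewrite /clamp.
  move: `|u - v| => r r0 uvr.
  by case: (leP 1 u) => ?; case: (leP 1 v) => ?; case: (leP 0 u) => ?;
    case: (leP 0 v) => ?; rewrite ?(max_idPr ler01); lra.
by rewrite ler_norml lerNl opprB key andbT distrC key.
Qed.

Let pt t : E := x + clamp t *: e.

Let L_pt t : unit_segment e x (pt t).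
Proof. by exists (clamp t) => //; exact: clamp01. Qed.

(** Quasisymmetry at [pt s] with an end point of the segment at distance at least [1 / 2] as
    reference. *)
Let pt_modulus s t (r : R) : 0 <= r -> `|s - t| <= r / 2 ->
  mdist (h (pt s)) (h (pt t)) <= eta r * (2 * eta 1 * D).
Proof.
move=> r0 st; have /andP[c0 c1] := clamp01 s.
have [u u01 su] : exists2 u : R, 0 <= u <= 1 & 2^-1 <= `|clamp s - u|.
  have [th|th] := leP 2^-1 (clamp s).
    by exists 0; rewrite ?lexx ?ler01// subr0 ger0_norm.
  exists 1; rewrite ?lexx ?ler01// ler0_norm; first by rewrite opprB; lra.
  by rewrite subr_le0.
have Lu : unit_segment e x (x + u *: e) by exists u.
apply: (@le_trans _ _ (eta r * mdist (h (pt s)) (h (x + u *: e : E)))).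
  apply: (qs_le eta_le h_qs) => //; try exact: LK.
    by rewrite mdist_segment//; apply: lt_le_trans su; rewrite invr_gt0.
  rewrite !mdist_segment//; apply: le_trans (clamp_lipschitz _ _) _.
  apply: le_trans st _; exact: ler_wpM2l.
apply: ler_wpM2l; first exact: eta_ge0.
exact: (qs_segment_bound eta_le h_qs e1 LK).
Qed.

Let phi t := mdist (h x) (h (pt t)).

Let phi_dist s t : `|phi s - phi t| <= mdist (h (pt s)) (h (pt t)).
Proof.
rewrite ler_norml /phi; apply/andP; split.
  by rewrite lerNl opprB lerBlDl; exact: metric_triangle.
by rewrite lerBlDl [mdist (h (pt s)) _]metric_sym; exact: metric_triangle.
Qed.

Let phi_continuous : continuous phi.
Proof.
move=> t; apply/cvgrPdist_le => q q0.
have m0 : 0 <= 2 * eta 1 * D by rewrite !mulr_ge0 ?eta_ge0// ltW.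
have [r r0 rq] := eta_small (divr_gt0 q0 (ltr_wpDl m0 ltr01)).
have r20 : 0 < r / 2 by rewrite divr_gt0.
near=> s; apply: le_trans (phi_dist _ _) _.
apply: le_trans (pt_modulus (ltW r0) _) _.
  by near: s; exact: cvgr_dist_le.
apply: le_trans (ler_wpM2r m0 rq) _.
rewrite mulrAC ler_pdivrMr ?ltr_wpDl// ler_wpM2l ?(ltW q0)// lerDl.
exact: ler01.
Unshelve. all: by end_near. Qed.

(** In dimension below 1 the image would have a cover of total diameter at most [D / 4]. The
    distance to [h x] sends the [k]-th set into an interval of half-length [d k]. By the
    intermediate value theorem these intervals cover [[0, D]], but their total length is at most
    [D / 2]. *)
Lemma hausdorff_dim_segment_ge1 : (1 <= hausdorff_dim (h @` unit_segment e x))%E.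
Proof.
rewrite leNgt; apply/negP => dim1.
have D4 : 0 < D / 4 by rewrite divr_gt0.
have dd01 : 0 < (1 : R) <= 1 by rewrite ltr01 lexx.
have [J [F [F_diam cF F_sum]]] := cover_of_dim dim1 dd01 D4.
pose d k := fine (diam (F k)).
have diamF k : J k -> diam (F k) = (d k)%:E.
  move=> Jk; rewrite fineK// ge0_fin_numE ?diam_ge0//.
  by apply: le_lt_trans (F_diam k Jk) _; exact: ltry.
pose u k := xget (h x) (F k).
pose I k : set R := if k \in J
  then `[mdist (h x) (u k) - d k, mdist (h x) (u k) + d k]%classic else set0.
have cI : `[0, D]%classic `<=` \bigcup_k I k.
  move=> v /=; rewrite in_itv/= => /andP[v0 vD].
  have phi0 : phi 0 = 0.
    by rewrite /phi /pt clamp_id ?lexx ?ler01// scale0r addr0 mdistxx.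
  have phi1 : phi 1 = D by rewrite /phi /pt clamp_id ?lexx ?ler01// scale1r.
  have [t _ phit] : exists2 t, t \in `[0, 1] & phi t = v.
    apply: IVT => //; first exact: continuous_subspaceT.
    by rewrite phi0 phi1 (min_idPl (ltW D_gt0)) (max_idPr (ltW D_gt0)) v0.
  have [k Jk Fk] := cF _ (imageP h (L_pt t)).
  exists k => //; rewrite /I mem_set//= in_itv/= -phit.
  have Fu : F k (u k) by exact: (@xgetPex _ (h x) _ (ex_intro _ _ Fk)).
  have : mdist (h (pt t)) (u k) <= d k.
    by rewrite -lee_fin -diamF//; exact: mdist_le_diam.
  have := metric_triangle (h x) (u k) (h (pt t)).
  have := metric_triangle (h x) (h (pt t)) (u k).
  rewrite [mdist (u k) _]metric_sym /phi.
  by move=> h1 h2 h3; apply/andP; split; lra.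
pose mu := @lebesgue_measure R.
have : (mu (`[0%R, D]%classic : set R) <= \sum_(0 <= k <oo) mu (I k))%E.
  apply: measure_sigma_subadditive => // k.
  by rewrite /I; case: ifP.
rewrite /mu lebesgue_measure_itv/= lte_fin D_gt0 oppr0 adde0.
have le2 : (\sum_(0 <= k <oo) mu (I k) <= (2 * (D / 4))%:E)%E.
  rewrite EFinM; apply: le_trans (lee_wpmul2l _ F_sum); last by rewrite lee_fin.
  rewrite -nneseriesZl; last by move=> k _; rewrite lee_fin powR_ge0.
  rewrite [leRHS]eseries_mkcond.
  apply: lee_nneseries => // k _; rewrite /I; case: ifPn => [/set_mem Jk|_].
    have d0 : 0 <= d k by rewrite fine_ge0// diam_ge0.
    rewrite /mu lebesgue_measure_itv/= lte_fin; case: ifP => _.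
      by rewrite -EFinD lee_fin powRr1// -/(d k); lra.
    by rewrite -EFinM lee_fin mulr_ge0// powR_ge0.
  by rewrite /mu measure0.
by move=> /le_trans/(_ le2); rewrite lee_fin; move: D_gt0; lra.
Qed.

End dimension_lower_bound.

(** * The main theorem *)

Lemma outer_measure_null_bigcup (R : realType) (T : Type)
    (mu : {outer_measure set T -> \bar R}) (A : set T) (F : nat -> set T) :
  A `<=` \bigcup_k F k -> (forall k, mu (F k) = 0%E) -> mu A = 0%E.
Proof.
move=> AF F0; apply/eqP; rewrite eq_le outer_measure_ge0 andbT.
apply: le_trans (le_outer_measure mu _ _ AF) _.
apply: le_trans (outer_measure_sigma_subadditive mu _) _.
by rewrite eseries0.
Qed.

Lemma ltVnat_ereal (R : realType) (v : \bar R) : (0 < v)%E ->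
  exists m : nat, forall k, (m <= k)%N -> ((k.+1%:R^-1)%:E < v)%E.
Proof.
move: v => [r| |]//; last by exists 0%N => k _; rewrite ltry.
rewrite lte_fin => r0; exists (Num.truncn r^-1) => k mk.
rewrite lte_fin invf_plt ?posrE//.
by apply: lt_le_trans (truncnS_gt _) _; rewrite ler_nat.
Qed.

Theorem corollary1p11 (R : realType) (n : nat) (n_ge2 : (2 <= n)%N)
    (maximal_conj : kakeya_maximal_conjecture R n)
    (K : set (euclidean R n)) (K_kakeya : kakeya_set K)
    (X : metricType R) (dimX : (hausdorff_dim [set: X] <= n%:R%:E)%E)
    (g : set_type K -> X) (g_qs : quasisymmetric g) :
  hausdorff_measure n.-1%:R
    [set e : euclidean R n | unit_sphere e /\
      exists x : euclidean R n, unit_segment e x `<=` K /\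
        hausdorff_dim (g @` (set_val @^-1` unit_segment e x)) <> 1%E] = 0%E.
Proof.
have [[[_ g_inj _] _ _] [eta [[[eta_fun _ eta_surj] _ _] eta_lt qs]]] := g_qs.
have eta_ge0 t : 0 <= t -> 0 <= eta t by move=> t0; exact: eta_fun.
have eta_le s t : 0 <= s -> s <= t -> eta s <= eta t.
  move=> s0; rewrite le_eqVlt => /predU1P[->//|st].
  by apply/ltW/eta_lt; rewrite ?inE//= (le_trans s0)// ltW.
(* A preimage [t] of [q] cannot be 0: by monotonicity and surjectivity [eta 0 = 0]. *)
have eta_small q : 0 < q -> exists2 t, 0 < t & eta t <= q.
  move=> q0; have [t /= t0 tq] := eta_surj q (ltW q0).
  exists t; rewrite ?tq// lt_neqAle t0 andbT; apply/eqP => t0'.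
  have [z /= z0 zq] := eta_surj 0 (lexx 0).
  move: tq; rewrite -t0' => tq.
  by have := eta_le 0 z (lexx 0) z0; rewrite zq tq leNgt q0.
have [[k0 Kk0]|Kempty] := pselect (exists y, K y); last first.
  rewrite [X in hausdorff_measure _ X](_ : _ = set0) ?hausdorff_measure0//.
  rewrite -subset0 => e [_ [x [LK _]]]; apply: Kempty; exists x; apply: LK.
  by exists 0; rewrite /= ?lexx ?ler01// scale0r addr0.
(* [g] is extended by a constant off [K], so that segments can be handled without subtypes. *)
pose h (y : euclidean R n) : X :=
  if insub y is Some k then g k else g (SigSub (mem_set Kk0)).
have hE (k : set_type K) : h (set_val k) = g k by rewrite /h valK.
have lift y : K y -> exists k : set_type K, set_val k = y.
  by move=> Ky; exists (SigSub (mem_set Ky)).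
have h_inj y z : K y -> K z -> h y = h z -> y = z.
  move=> /lift[ky <-] /lift[kz <-]; rewrite !hE => gg.
  by rewrite (g_inj ky kz)// inE.
have h_qs x y z : K x -> K y -> K z -> x <> z ->
    mdist (h x) (h y) <= eta (mdist x y / mdist x z) * mdist (h x) (h z).
  move=> Kx Ky Kz xz; rewrite -ler_pdivrMr; last first.
    by rewrite mdist_gt0; apply/eqP => hxz; exact: xz (h_inj _ _ Kx Kz hxz).
  have [kx kxE] := lift x Kx; have [ky kyE] := lift y Ky; have [kz kzE] := lift z Kz.
  have := qs kx ky kz; rewrite -!hE -kxE -kyE -kzE; apply.
  by move=> kk; apply: xz; rewrite -kxE -kzE kk.
pose D (e x : euclidean R n) := mdist (h x) (h (x + e : euclidean R n)).
have D_gt0 (e x : euclidean R n) : unit_sphere e -> unit_segment e x `<=` K -> 0 < D e x.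
  move=> e1 LK.
  have Lx : unit_segment e x x.
    by exists 0; rewrite /= ?lexx ?ler01// scale0r addr0.
  have Lxe : unit_segment e x (x + e).
    by exists 1; rewrite /= ?lexx ?ler01// scale1r.
  rewrite mdist_gt0; apply/eqP => hxe; have xxe := h_inj _ _ (LK _ Lx) (LK _ Lxe) hxe.
  have := @mdist_segment R n e x 0 1 e1.
  rewrite scale0r addr0 scale1r -xxe mdistxx sub0r normrN normr1 => /eqP.
  by rewrite eq_sym oner_eq0.
(* The exponents [1 + 2 / (m + 1)] decrease to 1, so an image of dimension above 1 has positive
   measure for one of them. *)
pose S m := [set e : euclidean R n | unit_sphere e /\ exists x : euclidean R n,
  unit_segment e x `<=` K /\
  (0 < hausdorff_measure (1 + 2 * m.+1%:R^-1) (h @` unit_segment e x))%E].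
pose c m : R := m.+1%:R^-1.
have c0 m : 0 < c m by rewrite invr_gt0.
apply: (@outer_measure_null_bigcup _ _
  [the {outer_measure set _ -> \bar R} of @hausdorff_measure R (euclidean R n) n.-1%:R] _ S).
  move=> e [e1 [x [LK dim1]]].
  have gh : g @` (set_val @^-1` unit_segment e x) = h @` unit_segment e x.
    apply/seteqP; split => [_ [k Lk <-]|_ [y Ly <-]].
      by exists (set_val k) => //; exact: hE.
    have [k kE] := lift y (LK y Ly).
    by exists k; rewrite /= ?kE// -hE kE.
  rewrite gh in dim1.
  have := hausdorff_dim_segment_ge1 eta_ge0 eta_le eta_small h_qs e1 LK (D_gt0 _ _ e1 LK).
  rewrite le_eqVlt => /predU1P[/esym//|dim_gt1].
  have [m hm] : exists m : nat, ((1 + 2 * c m)%:E < hausdorff_dim (h @` unit_segment e x))%E.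
    move: dim_gt1; case: (hausdorff_dim _) => [r| |]//; last by exists 0%N; rewrite ltry.
    rewrite lte_fin -subr_gt0 => r1.
    have [|m mr] := @ltVnat_ereal R ((r - 1) / 2)%:E; first by rewrite lte_fin divr_gt0.
    by exists m; have := mr m (leqnn m); rewrite !lte_fin -/(c m); lra.
  exists m => //; split => //; exists x; split => //.
  rewrite lt_neqAle hausdorff_measure_ge0 andbT eq_sym; apply/eqP => H0.
  move: hm; rewrite ltNge => /negP; apply; apply: ereal_inf_lbound.
  exists (1 + 2 * c m) => //=; split => //.
  by rewrite addr_ge0// mulr_ge0// ltW.
move=> m.
(* Positive measure means positive content at some scale [d]. Bounding [D e x] on both sides, [d]
   from below and the content from below are conditions that hold for all large [k], and a smaller
   scale only increases the content. *)
apply: (@outer_measure_null_bigcup _ _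
  [the {outer_measure set _ -> \bar R} of @hausdorff_measure R (euclidean R n) n.-1%:R] _
  (fun k => [set e : euclidean R n | unit_sphere e /\ exists x : euclidean R n,
      [/\ unit_segment e x `<=` K, c k <= D e x <= k.+1%:R
      & ((c k)%:E <= hausdorff_content (1 + 2 * c m) (c k) (h @` unit_segment e x))%E]])).
  move=> e [e1 [x [LK /ereal_sup_gt[_ [d /= d0 <-] Hd]]]].
  have [k1 hk1] := ltVnat_ereal Hd.
  have [|k2 hk2] := @ltVnat_ereal R d%:E; first by rewrite lte_fin.
  have [|k3 hk3] := @ltVnat_ereal R (D e x)%:E; first by rewrite lte_fin; exact: D_gt0.
  pose k := maxn (maxn k1 k2) (maxn k3 (Num.truncn (D e x))).
  exists k => //; split => //; exists x; split => //.
    have := hk3 k; rewrite lte_fin => /(_ _)/ltW ->//=; last by rewrite !leq_max leqnn !orbT.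
    apply: le_trans (ltW (truncnS_gt _)) _.
    by rewrite ler_nat ltnS !leq_max leqnn !orbT.
  apply: le_trans (ltW (hk1 k _)) _; first by rewrite !leq_max leqnn.
  apply: le_hausdorff_content; rewrite -lee_fin ltW//; apply: hk2.
  by rewrite !leq_max leqnn !orbT.
move=> k; apply: (exceptional_directions_null eta_ge0 eta_le eta_small h_qs) => //.
exact: ltnW.
Qed.
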